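(* Let $N\ge 1$ be an integer, $f_s>0$, let $x(t)$ be an input signal with Fourier transform $X(f)$, and let $\mathbf{s}=(s_0,\dots,s_{N-1})\in\mathbb{R}^N$ be the timing-skew sequence, where $s_n$ is the skew of the $n$th of the $N$ sub-ADCs of an interleaved ADC of total rate $f_s$. Let the output of the $n$th sub-ADC be $$y^{\mathrm{s}}_n(t)=x(t-s_n)\sum_{k\in\mathbb{Z}}\delta\left(t-k\frac{N}{f_s}-\frac{n}{f_s}\right),\qquad n=0,\dots,N-1,$$ and let $Y^{\mathrm{s}}(f)$ be the Fourier transform of the interleaved output $\sum_{n=0}^{N-1}y^{\mathrm{s}}_n(t)$. Let $Y^{\mathrm{id}}(f)$ be the Fourier transform of the ideally sampled output $y^{\mathrm{id}}(t)=x(t)\sum_{k\in\mathbb{Z}}\delta\left(t-\frac{k}{f_s}\right)$. Assume that $x(t)$ is band-limited to $f_{\max}$ and that the skew $s_n$ of each sub-ADC is small compared to the period $1/f_{\max}$, so that the Fourier transform of $x(t-s_n)$ can be approximated as $$X(f)\,e^{-2\pi j f s_n}\approx X(f)(1-2\pi j f s_n).$$ Then $Y^{\mathrm{s}}$ can be approximated as $$Y^{\mathrm{s}}(f)\approx Y^{\mathrm{id}}(f)-f_s\,\bigl(2\pi j f X(f)\bigr)\ast\sum_{k\in\mathbb{Z}}\tilde{s}_{k\bmod N}\,\delta\left(f-k\frac{f_s}{N}\right),$$ where $\tilde{\mathbf{s}}$ is the normalized DFT of $\mathbf{s}$ and $\ast$ is convolution in the variable $f$.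
   Context: The Fourier transform is $X(f)=\int x(t)e^{-2\pi j f t}\,dt$, with $j$ the imaginary unit, and $\delta$ is the Dirac distribution. For $\mathbf{u}\in\mathbb{C}^N$ with entries $u_0,\dots,u_{N-1}$, the normalized DFT is $\tilde u_k=\frac1N\sum_{n=0}^{N-1}e^{-2\pi j kn/N}u_n$ for $k=0,\dots,N-1$. The index $k\bmod N$ is taken in $\{0,\dots,N-1\}$. The sign $\approx$ denotes the first-order approximation in the skews, i.e. the result of replacing $X(f)e^{-2\pi j f s_n}$ by $X(f)(1-2\pi j f s_n)$ for every $n$; no quantitative error bound is given. *)

(* Defs.v *)
From mathcomp Require Import all_boot all_order all_algebra.
From mathcomp Require Import all_classical all_reals all_analysis.
From mathcomp.real_closed Require Import complex.

Set Implicit Arguments.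
Unset Strict Implicit.
Unset Printing Implicit Defensive.
Import Order.TTheory GRing.Theory Num.Theory.
Import numFieldNormedType.Exports.
Local Open Scope classical_set_scope.
Local Open Scope ring_scope.
Local Open Scope complex_scope.

(* Complex-valued calculus is done componentwise: the library has Lebesgue
   integration, derivatives and series for real-valued functions. *)
Section ComplexCalculus.
Variable R : realType.

Definition expj (theta : R) : R[i] := cos theta +i* sin theta.

Definition ccontinuous (h : R -> R[i]) : Prop :=
  continuous (fun t => complex.Re (h t)) /\ continuous (fun t => complex.Im (h t)).

Definition cintegrable (h : R -> R[i]) : Prop :=
  (@lebesgue_measure R).-integrable setT (fun t => (complex.Re (h t))%:E) /\
  (@lebesgue_measure R).-integrable setT (fun t => (complex.Im (h t))%:E).

Definition cintegral (h : R -> R[i]) : R[i] :=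
  (\int[@lebesgue_measure R]_t complex.Re (h t)) +i*
  (\int[@lebesgue_measure R]_t complex.Im (h t)).

Definition sumZ (a : int -> R) : R :=
  limn (series (fun k => a (Posz k))) + limn (series (fun k => a (Negz k))).

Definition csumZ (a : int -> R[i]) : R[i] :=
  sumZ (fun k => complex.Re (a k)) +i* sumZ (fun k => complex.Im (a k)).

End ComplexCalculus.

(* A distribution is represented by its action on functions; only its values
   on test functions (and, on the time side, on Fourier transforms of test
   functions) are meaningful.  Two distributions are equal, [A =d B], when they
   agree on all compactly supported smooth functions.  The Fourier transforms
   below are tempered, so this is also equality as tempered distributions. *)
Section Distributions.
Variable R : realType.

Definition distr : Type := (R -> R[i]) -> R[i].

Definition smooth (h : R -> R) : Prop :=
  forall (n : nat) (t : R), derivable (derive1n n h) t 1.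

Definition test_function (phi : R -> R[i]) : Prop :=
  [/\ smooth (fun t => complex.Re (phi t)), smooth (fun t => complex.Im (phi t)) &
      exists B : R, forall t, B < `|t| -> phi t = 0].

Definition distr_eq (A B : distr) : Prop :=
  forall phi, test_function phi -> A phi = B phi.

Definition delta (a : R) : distr := fun phi => phi a.

Definition distr_series (T : int -> distr) : distr :=
  fun phi => csumZ (fun k => T k phi).

Definition distr_of_fun (x : R -> R[i]) : distr :=
  fun phi => cintegral (fun t => x t * phi t).

(* Product of a function with a distribution. *)
Definition distr_mul (h : R -> R[i]) (T : distr) : distr :=
  fun phi => T (fun t => h t * phi t).

(* The convolution A * B, for A with compact support. *)
Definition distr_conv (A B : distr) : distr :=
  fun phi => B (fun v => A (fun u => phi (u + v))).

Definition fourier_fun (phi : R -> R[i]) : R -> R[i] :=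
  fun f => cintegral (fun t => phi t * expj (- (2 * pi * f * t))).

Definition fourier (T : distr) : distr := fun phi => T (fourier_fun phi).

(* The support of T is contained in [- fmax, fmax]. *)
Definition band_limited (fmax : R) (T : distr) : Prop :=
  forall phi, test_function phi ->
    closure [set f | phi f != 0] `<=` [set f | fmax < `|f|] -> T phi = 0.

(* Functions defining a tempered distribution, e.g. those in L^1, in L^2, or
   bounded measurable (such as sinusoids). *)
Definition tempered_fun (x : R -> R[i]) : Prop :=
  exists m : nat, cintegrable (fun t => ((1 + t ^+ 2) ^- m)%:C * x t).

End Distributions.

Notation "A =d B" := (distr_eq A B) (at level 70, no associativity).

Section InterleavedADC.
Variables (R : realType) (N : nat) (fs : R).

(* sum over k in Z of delta (t - k T - tau) *)
Definition dirac_comb (T tau : R) : distr R :=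
  distr_series (fun k => delta (k%:~R * T + tau)).

(* Sampling instants of the n-th sub-ADC. *)
Definition sub_comb (n : nat) : distr R :=
  dirac_comb (N%:R / fs) (n%:R / fs).

Definition y_skew (x : R -> R[i]) (s : 'I_N -> R) (n : 'I_N) : distr R :=
  distr_mul (fun t => x (t - s n)) (sub_comb n).

Definition Y_skew (x : R -> R[i]) (s : 'I_N -> R) : distr R :=
  fourier (\sum_(n < N) y_skew x s n).

Definition y_ideal (x : R -> R[i]) : distr R :=
  distr_mul x (dirac_comb fs^-1 0).

Definition Y_ideal (x : R -> R[i]) : distr R := fourier (y_ideal x).

(* Spectrum of the interleaved output when the signal sampled by the n-th
   sub-ADC has spectrum Z n; sampling is a product in time, hence a
   convolution in frequency. *)
Definition interleaved_spectrum (Z : 'I_N -> distr R) : distr R :=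
  \sum_(n < N) distr_conv (Z n) (fourier (sub_comb n)).

(* Y ~ Y' to first order in the skews: Y is the interleaved spectrum of the
   X(f) e^{- 2 pi j f s_n}, and replacing each of these by
   X(f) (1 - 2 pi j f s_n) turns it into Y'. *)
Definition skew_approx (X : distr R) (s : 'I_N -> R) (Y Y' : distr R) : Prop :=
  Y =d interleaved_spectrum
         (fun n => distr_mul (fun f => expj (- (2 * pi * f * s n))) X) /\
  interleaved_spectrum
    (fun n => distr_mul (fun f => 1 - (2 * pi * f * s n)*i) X) =d Y'.

(* Normalized DFT; only the indices k < N are meaningful. *)
Definition ndft (u : 'I_N -> R[i]) (k : nat) : R[i] :=
  N%:R^-1 * \sum_(n < N) expj (- (2 * pi * k%:R * n%:R / N%:R)) * u n.

(* sum over k in Z of u~_(k mod N) delta (f - k fs / N) *)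
Definition ndft_comb (u : 'I_N -> R[i]) : distr R :=
  distr_series (fun k : int =>
    ndft u (absz (k %% N%:Z)%Z) *: (delta (k%:~R * (fs / N%:R)) : distr R)).

End InterleavedADC.

(* Main.v *)
(** For a test function phi put G_phi(v) := X(phi(. + v)), i.e. the inverse
    Fourier transform of x * F phi.  Band-limitation makes G_phi compactly
    supported, and Fourier inversion gives F G_phi = x * F phi pointwise.  Taking
    phi(u) e^{-2 pi j u s} in place of phi shows that convolving X e^{-2 pi j f s}
    with the transform of a comb samples x(t - s), which is the first half of
    the approximation.

    For the second half, linearity in X reduces the interleaved spectrum of
    X (1 - 2 pi j f s_n) to the samples of x * F phi, which regroup into the ideal
    output, minus s_n times the samples of F Psi, where
    Psi(v) := (2 pi j f X)(phi(. + v)).  Poisson summation turns the samples of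
    F Psi at k N / fs + n / fs into fs / N times the sum over k of
    e^{-2 pi j k n / N} Psi(k fs / N), and summing over n with the weights s_n
    produces the normalized DFT of s. *)
Require Import Defs.
From mathcomp Require Import all_boot all_order all_algebra.
From mathcomp Require Import all_classical all_reals all_analysis measurable_realfun.
From mathcomp.real_closed Require Import complex.
From mathcomp Require Import ring lra zify.
Import Order.TTheory GRing.Theory Num.Theory.
Import numFieldNormedType.Exports.
Set Implicit Arguments.
Unset Strict Implicit.
Unset Printing Implicit Defensive.
Local Open Scope classical_set_scope.
Local Open Scope ring_scope.
Local Open Scope complex_scope.

(** * Componentwise complex integration *)

(** Equality [=d] speaks of test functions only, but the convolutions evaluate transforms of combs
    on G_phi, which is not shown to be a test function. Identities for G_phi and Psi are therefore
    proved pointwise, from the single fact that X acts on shifted test functions by integration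
    against x. Little regularity is available. The function x * F phi is merely continuous with an
    integrable first moment, and its transform merely continuous with compact support, so inversion
    damps the integral by e^{- e |v|} and lets e tend to 0. Multiplying X by 2 pi j f does not
    commute with shifting phi, so Psi is a combination of G functions with one coefficient linear in
    v. [csumZ] adds two one-sided limits, each with a default value when it does not exist. The
    second half therefore needs convergence of both halves of every series. For the samples of x * F
    phi it follows from quadratic decay. For those of F Psi no rate is established: they are Fourier
    coefficients of a periodization that is Lipschitz at 0, and Chernoff's telescoping argument sums
    them there. *)

Section cabs.
Variable R : realType.
Implicit Types (z w : R[i]) (a b : R).
Local Notation Re := complex.Re.
Local Notation Im := complex.Im.

Lemma cReM z w : Re (z * w) = Re z * Re w - Im z * Im w.
Proof. by case: z; case: w. Qed.
Lemma cImM z w : Im (z * w) = Re z * Im w + Im z * Re w.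
Proof. by case: z; case: w. Qed.
Lemma cReD z w : Re (z + w) = Re z + Re w.
Proof. by case: z; case: w. Qed.
Lemma cImD z w : Im (z + w) = Im z + Im w.
Proof. by case: z; case: w. Qed.
Lemma cReN z : Re (- z) = - Re z.
Proof. by case: z. Qed.
Lemma cImN z : Im (- z) = - Im z.
Proof. by case: z. Qed.
Definition cReE := (cReM, cReD, cReN).
Definition cImE := (cImM, cImD, cImN).

Lemma ceqP z w : Re z = Re w -> Im z = Im w -> z = w.
Proof. by case: z; case: w => a b c d /= -> ->. Qed.

Lemma cRe_sum (I : Type) (r : seq I) (P : pred I) (F : I -> R[i]) :
  Re (\sum_(i <- r | P i) F i) = \sum_(i <- r | P i) Re (F i).
Proof. by exact: (big_morph (complex.Re (R:=R)) cReD erefl). Qed.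
Lemma cIm_sum (I : Type) (r : seq I) (P : pred I) (F : I -> R[i]) :
  Im (\sum_(i <- r | P i) F i) = \sum_(i <- r | P i) Im (F i).
Proof. by exact: (big_morph (complex.Im (R:=R)) cImD erefl). Qed.

(* The l1 norm is real-valued, submultiplicative, and satisfies the triangle
   inequality for componentwise integrals without any constant. *)
Definition cabs z : R := `|Re z| + `|Im z|.

Lemma cabs_ge0 z : 0 <= cabs z. Proof. exact: addr_ge0. Qed.
Lemma cabs0 : cabs 0 = 0. Proof. by rewrite /cabs/= normr0 addr0. Qed.
Lemma cabsN z : cabs (- z) = cabs z.
Proof. by rewrite /cabs cReN cImN !normrN. Qed.
Lemma cabsD z w : cabs (z + w) <= cabs z + cabs w.
Proof.
rewrite /cabs cReD cImD addrACA; apply: lerD; exact: ler_normD.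
Qed.
Lemma cabsM z w : cabs (z * w) <= cabs z * cabs w.
Proof.
rewrite /cabs cReM cImM mulrDl !mulrDr -!normrM.
set p := Re z * Re w; set q := Im z * Im w.
set u := Re z * Im w; set v := Im z * Re w.
have := ler_normB p q; have := ler_normD u v; lra.
Qed.
Lemma cabs_real a : cabs a%:C = `|a|.
Proof. by rewrite /cabs/= normr0 addr0. Qed.
Lemma cabs_i a : cabs (a *i) = `|a|.
Proof. by rewrite /cabs/= normr0 add0r. Qed.
Lemma cabs_Re z : `|Re z| <= cabs z. Proof. by rewrite /cabs lerDl. Qed.
Lemma cabs_Im z : `|Im z| <= cabs z. Proof. by rewrite /cabs lerDr. Qed.
Lemma cabs_le0 z : cabs z <= 0 -> z = 0.
Proof.
move=> z0; apply: ceqP => /=; apply/eqP; rewrite -normr_le0.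
  exact: le_trans (cabs_Re _) z0.
exact: le_trans (cabs_Im _) z0.
Qed.

Lemma expjD a b : expj (a + b) = expj a * expj b.
Proof. by apply: ceqP; rewrite (cReM, cImM) /= ?cosD ?sinD; ring. Qed.
Lemma expj0 : expj (0 : R) = 1.
Proof. by rewrite /expj cos0 sin0. Qed.
Lemma cabs_expj a : cabs (expj a) <= 2.
Proof.
rewrite /cabs /=; have := cos_le1 a; have := cos_geN1 a.
have := sin_le1 a; have := sin_geN1 a => h1 h2 h3 h4.
have H1 : `|cos a| <= 1 by rewrite ler_norml; apply/andP.
have H2 : `|sin a| <= 1 by rewrite ler_norml; apply/andP.
lra.
Qed.

Lemma derive_lipschitz (f df : R -> R) (K : R) :
  (forall x : R, is_derive x (1 : R) f (df x)) -> (forall x, `|df x| <= K) ->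
  forall a b, `|f a - f b| <= K * `|a - b|.
Proof.
move=> fd dfK a b.
wlog ab : a b / a < b => [H|].
  have [ab|ba|->] := ltgtP a b; first exact: H.
    by rewrite distrC (distrC a); exact: H.
  by rewrite !subrr normr0 mulr0.
have [|c _ E] := MVT ab (fun x _ => fd x).
  apply: continuous_subspaceT => x.
  by apply/differentiable_continuous/derivable1_diffP; exact: ex_derive.
rewrite distrC E normrM (distrC a); exact: ler_wpM2r.
Qed.

Lemma sin_lipschitz a b : `|sin a - sin b| <= `|a - b|.
Proof.
rewrite -[leRHS]mul1r; apply: (@derive_lipschitz sin cos) => x.
by rewrite ler_norml cos_geN1 cos_le1.
Qed.

Lemma cos_lipschitz a b : `|cos a - cos b| <= `|a - b|.
Proof.
rewrite -[leRHS]mul1r.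
apply: (@derive_lipschitz cos (fun x => - sin x)) => x.
by rewrite normrN ler_norml sin_geN1 sin_le1.
Qed.

Lemma cabs_expjB a b : cabs (expj a - expj b) <= 2 * `|a - b|.
Proof.
rewrite /cabs cReD cImD cReN cImN /=.
have := sin_lipschitz a b; have := cos_lipschitz a b; lra.
Qed.

End cabs.

(** * Complex integrals over a set: linearity, domination, measurability *)

Section cintegral_on.
Variable R : realType.
Implicit Types (D : set R) (h g u : R -> R[i]) (z w c : R[i]) (a b : R).
Local Notation Re := (@complex.Re R).
Local Notation Im := (@complex.Im R).
Local Notation mu := (@lebesgue_measure R).

Definition cmeasurable D h :=
  measurable_fun D (fun t => Re (h t)) /\ measurable_fun D (fun t => Im (h t)).
Definition cintegrable_on D h :=
  mu.-integrable D (fun t => (Re (h t))%:E) /\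
  mu.-integrable D (fun t => (Im (h t))%:E).
Definition cintegral_on D h : R[i] :=
  (\int[mu]_(t in D) Re (h t)) +i* (\int[mu]_(t in D) Im (h t)).

Lemma cintegral_onT h : cintegral h = cintegral_on setT h. Proof. by []. Qed.

Lemma eq_cintegral_on D h g : (forall t, D t -> h t = g t) ->
  cintegral_on D h = cintegral_on D g.
Proof.
move=> hg; congr (_ +i* _); apply: eq_Rintegral => t /set_mem Dt; by rewrite hg.
Qed.

Lemma eq_cintegrable_on D h g : (forall t, D t -> h t = g t) ->
  measurable D -> cintegrable_on D h -> cintegrable_on D g.
Proof.
by move=> hg mD [h1 h2]; split; [move: h1|move: h2]; apply: eq_integrable => //;
  move=> t /set_mem Dt; rewrite hg.
Qed.

Lemma cintegrable_onD D h g : measurable D ->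
  cintegrable_on D h -> cintegrable_on D g ->
  cintegrable_on D (fun t => h t + g t).
Proof.
move=> mD [h1 h2] [g1 g2]; split; under eq_fun do rewrite (cReE, cImE) EFinD;
  exact: integrableD.
Qed.

Lemma cintegral_onD D h g : measurable D ->
  cintegrable_on D h -> cintegrable_on D g ->
  cintegral_on D (fun t => h t + g t) = cintegral_on D h + cintegral_on D g.
Proof.
move=> mD [h1 h2] [g1 g2]; apply: ceqP; rewrite (cReD, cImD) /=.
  by under eq_Rintegral do rewrite cReD; rewrite RintegralD.
by under eq_Rintegral do rewrite cImD; rewrite RintegralD.
Qed.

Lemma integrable_onZl D (f : R -> R) a : measurable D ->
  mu.-integrable D (fun t => (f t)%:E) ->
  mu.-integrable D (fun t => (a * f t)%:E).
Proof. by move=> mD fi; under eq_fun do rewrite EFinM; exact: integrableZl. Qed.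

Lemma integrable_onB D (f k : R -> R) : measurable D ->
  mu.-integrable D (fun t => (f t)%:E) ->
  mu.-integrable D (fun t => (k t)%:E) ->
  mu.-integrable D (fun t => (f t - k t)%:E).
Proof. by move=> mD fi ki; under eq_fun do rewrite EFinB; exact: integrableB. Qed.

Lemma integrable_onD D (f k : R -> R) : measurable D ->
  mu.-integrable D (fun t => (f t)%:E) ->
  mu.-integrable D (fun t => (k t)%:E) ->
  mu.-integrable D (fun t => (f t + k t)%:E).
Proof. by move=> mD fi ki; under eq_fun do rewrite EFinD; exact: integrableD. Qed.

Lemma cintegrable_onZ D c h : measurable D -> cintegrable_on D h ->
  cintegrable_on D (fun t => c * h t).
Proof.
move=> mD [h1 h2]; split; under eq_fun do rewrite (cReM, cImM).
  by apply: integrable_onB => //; exact: integrable_onZl.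
by apply: integrable_onD => //; exact: integrable_onZl.
Qed.

Lemma cintegral_onZ D c h : measurable D -> cintegrable_on D h ->
  cintegral_on D (fun t => c * h t) = c * cintegral_on D h.
Proof.
move=> mD [h1 h2]; apply: ceqP; rewrite (cReM, cImM) /=.
  under eq_Rintegral do rewrite cReM.
  by rewrite RintegralB ?RintegralZl//; exact: integrable_onZl.
under eq_Rintegral do rewrite cImM.
by rewrite RintegralD ?RintegralZl//; exact: integrable_onZl.
Qed.

Lemma cintegral_onB D h g : measurable D ->
  cintegrable_on D h -> cintegrable_on D g ->
  cintegral_on D (fun t => h t - g t) = cintegral_on D h - cintegral_on D g.
Proof.
move=> mD hi gi; rewrite -[in RHS]mulN1r -cintegral_onZ// -cintegral_onD//.
  by apply: eq_cintegral_on => t _; rewrite mulN1r.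
exact: cintegrable_onZ.
Qed.

Lemma cintegrable_onB D h g : measurable D ->
  cintegrable_on D h -> cintegrable_on D g ->
  cintegrable_on D (fun t => h t - g t).
Proof.
move=> mD hi gi; under eq_fun do rewrite -(mulN1r (g _)).
by apply: cintegrable_onD => //; exact: cintegrable_onZ.
Qed.

Lemma cintegral_on0 D : cintegral_on D (fun=> 0) = 0.
Proof. by apply: ceqP => /=; rewrite /Rintegral integral0. Qed.

Lemma cintegrable_on_sum D n (F : nat -> R -> R[i]) : measurable D ->
  (forall i, (i < n)%N -> cintegrable_on D (F i)) ->
  cintegrable_on D (fun t => \sum_(i < n) F i t).
Proof.
move=> mD; elim: n => [|n IH] Fi.
  by under eq_fun do rewrite big_ord0; split; exact: integrable0.
under eq_fun do rewrite big_ord_recr /=.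
apply: cintegrable_onD => //; last exact: Fi.
by apply: IH => i ilt; apply: Fi; exact: ltnW.
Qed.

Lemma cintegral_on_sum D n (F : nat -> R -> R[i]) : measurable D ->
  (forall i, (i < n)%N -> cintegrable_on D (F i)) ->
  cintegral_on D (fun t => \sum_(i < n) F i t) =
  \sum_(i < n) cintegral_on D (F i).
Proof.
move=> mD; elim: n => [|n IH] Fi.
  by under eq_fun do rewrite big_ord0; rewrite big_ord0 cintegral_on0.
under eq_fun do rewrite big_ord_recr /=.
have Fi' i : (i < n)%N -> cintegrable_on D (F i).
  by move=> ilt; apply: Fi; exact: ltnW.
rewrite big_ord_recr /= cintegral_onD ?IH//; first exact: cintegrable_on_sum.
exact: Fi.
Qed.

Lemma cintegrable_on_cabs D h : measurable D -> cintegrable_on D h ->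
  mu.-integrable D (fun t => (cabs (h t))%:E).
Proof.
move=> mD [h1 h2]; apply: integrable_onD => //; exact: integrable_norm.
Qed.

Lemma le_cintegral_on D h (k : R -> R) : measurable D ->
  cintegrable_on D h -> mu.-integrable D (fun t => (k t)%:E) ->
  (forall t, D t -> cabs (h t) <= k t) ->
  cabs (cintegral_on D h) <= \int[mu]_(t in D) k t.
Proof.
move=> mD hi ki hk; have [h1 h2] := hi.
apply: (@le_trans _ _ (\int[mu]_(t in D) cabs (h t))); last first.
  by apply: le_Rintegral => //; exact: cintegrable_on_cabs.
rewrite /cabs RintegralD//; [|exact: integrable_norm..].
by apply: lerD; exact: le_normr_Rintegral.
Qed.

Lemma cintegrable_on_le D h (k : R -> R) : measurable D -> cmeasurable D h ->
  mu.-integrable D (fun t => (k t)%:E) ->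
  (forall t, D t -> cabs (h t) <= k t) -> cintegrable_on D h.
Proof.
move=> mD [m1 m2] ki hk.
split; apply: (@le_integrable _ _ _ mu D mD _ (fun t => (k t)%:E)) => //.
- exact/measurable_EFinP.
- move=> t Dt /=; rewrite lee_fin; apply: le_trans (ler_norm _).
  exact: le_trans (cabs_Re _) (hk t Dt).
- exact/measurable_EFinP.
- move=> t Dt /=; rewrite lee_fin; apply: le_trans (ler_norm _).
  exact: le_trans (cabs_Im _) (hk t Dt).
Qed.

Lemma cintegrable_on_measurable D h : cintegrable_on D h -> cmeasurable D h.
Proof.
by move=> [/measurable_int/measurable_EFinP h1 /measurable_int/measurable_EFinP h2].
Qed.

Lemma cmeasurableM D h g : cmeasurable D h -> cmeasurable D g ->
  cmeasurable D (fun t => h t * g t).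
Proof.
move=> [h1 h2] [g1 g2]; split; under eq_fun do rewrite (cReE, cImE).
  by apply: measurable_funB; exact: measurable_funM.
by apply: measurable_funD; exact: measurable_funM.
Qed.

Lemma cintegrable_onM D h u (C : R) : measurable D -> cintegrable_on D h ->
  cmeasurable D u -> (forall t, D t -> cabs (u t) <= C) ->
  cintegrable_on D (fun t => u t * h t).
Proof.
move=> mD hi mu' uC.
apply: (@cintegrable_on_le _ _ (fun t => C * cabs (h t))) => //.
- by apply: cmeasurableM => //; exact: cintegrable_on_measurable.
- by apply: integrable_onZl => //; exact: cintegrable_on_cabs.
- move=> t Dt; apply: (le_trans (cabsM _ _)).
  by apply: ler_wpM2r; [exact: cabs_ge0|exact: uC].
Qed.

Lemma ccontinuous_cmeasurable D h : measurable D -> ccontinuous h ->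
  cmeasurable D h.
Proof.
by move=> mD [h1 h2]; split; apply: (measurable_funS measurableT) => //;
  exact: continuous_measurable_fun.
Qed.

Lemma ccontinuous_cst z : ccontinuous (fun _ : R => z).
Proof. by split => t; exact: cvg_cst. Qed.

Lemma ccontinuousD h g : ccontinuous h -> ccontinuous g ->
  ccontinuous (fun t => h t + g t).
Proof.
move=> [h1 h2] [g1 g2]; split => t.
  under eq_fun do rewrite cReD.
  exact: (continuousD (h1 t) (g1 t)).
under eq_fun do rewrite cImD.
exact: (continuousD (h2 t) (g2 t)).
Qed.

Lemma ccontinuousM h g : ccontinuous h -> ccontinuous g ->
  ccontinuous (fun t => h t * g t).
Proof.
move=> [h1 h2] [g1 g2]; split => t.
  under eq_fun do rewrite cReM.
  exact: (continuousB (continuousM (h1 t) (g1 t)) (continuousM (h2 t) (g2 t))).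
under eq_fun do rewrite cImM.
exact: (continuousD (continuousM (h1 t) (g2 t)) (continuousM (h2 t) (g1 t))).
Qed.

Lemma ccontinuous_expj (f : R -> R) : continuous f ->
  ccontinuous (fun t => expj (f t)).
Proof.
move=> fc; split => t /=; apply: continuous_comp; try exact: fc.
  exact: continuous_cos.
exact: continuous_sin.
Qed.

Lemma ccontinuous_C (f : R -> R) : continuous f ->
  ccontinuous (fun t => (f t)%:C).
Proof. by move=> fc; split => t //=; exact: cvg_cst. Qed.

Lemma ccontinuous_comp h (f : R -> R) : ccontinuous h -> continuous f ->
  ccontinuous (fun t => h (f t)).
Proof.
move=> [h1 h2] fc; split => t.
  exact: (continuous_comp (fc t) (h1 (f t))).
exact: (continuous_comp (fc t) (h2 (f t))).
Qed.

Lemma ccontinuous_sum n (F : nat -> R -> R[i]) :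
  (forall i, ccontinuous (F i)) -> ccontinuous (fun t => \sum_(i < n) F i t).
Proof.
move=> Fc; elim: n => [|n IH].
  by under eq_fun do rewrite big_ord0; exact: ccontinuous_cst.
by under eq_fun do rewrite big_ord_recr /=; exact: ccontinuousD.
Qed.

Lemma ccontinuous_integrable h a b : ccontinuous h -> cintegrable_on `[a, b] h.
Proof.
move=> [h1 h2]; split; apply: continuous_compact_integrable;
  try exact: segment_compact; exact: continuous_subspaceT.
Qed.

Lemma eq_cintegral_support D h : measurable D -> (forall t, ~ D t -> h t = 0) ->
  cintegral h = cintegral_on D h.
Proof.
move=> mD h0; rewrite /cintegral /cintegral_on.
rewrite ![\int[mu]_(t in D) _]Rintegral_mkcond.
congr (_ +i* _); apply: eq_Rintegral => t _; rewrite patchE;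
  by case: ifPn => // /negP tD; rewrite h0// => Dt; apply: tD; exact/mem_set.
Qed.

Lemma cintegrable_support D h : measurable D -> (forall t, ~ D t -> h t = 0) ->
  cintegrable_on D h -> cintegrable h.
Proof.
move=> mD h0 [h1 h2].
split; [have := (@integrable_mkcond _ _ _ mu _ _ mD).1 h1|have := (@integrable_mkcond _ _ _ mu _ _ mD).1 h2];
 apply: eq_integrable => // t _; rewrite patchE;
  by case: ifPn => // /negP tD; rewrite h0// => Dt; apply: tD; exact/mem_set.
Qed.
End cintegral_on.

(** * Calculus on intervals and for compactly supported functions *)

Section intervals.
Variable R : realType.
Implicit Types (h g u : R -> R[i]) (z w c : R[i]) (a b : R).
Local Notation Re := (@complex.Re R).
Local Notation Im := (@complex.Im R).
Local Notation mu := (@lebesgue_measure R).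

Lemma is_derive_continuous (F f : R -> R) :
  (forall x : R, is_derive x (1 : R) F (f x)) -> continuous F.
Proof.
move=> Ff x; apply/differentiable_continuous/derivable1_diffP.
by apply: ex_derive; exact: Ff.
Qed.

Lemma is_derive_oo_LRcontinuous (F f : R -> R) a b :
  (forall x : R, is_derive x (1 : R) F (f x)) -> derivable_oo_LRcontinuous F a b.
Proof.
move=> Ff; have Fc := is_derive_continuous Ff; split.
- by move=> x _; apply: ex_derive; exact: Ff.
- by apply: cvg_at_right_filter; exact: Fc.
- by apply: cvg_at_left_filter; exact: Fc.
Qed.

Lemma is_derive_derive1 (F f : R -> R) :
  (forall x : R, is_derive x (1 : R) F (f x)) -> derive1 F = f.
Proof. by move=> Ff; apply/funext => x; rewrite derive1E; have [_ ->] := Ff x. Qed.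

Lemma Rintegral_FTC (F f : R -> R) a b : a <= b -> continuous f ->
  (forall x : R, is_derive x (1 : R) F (f x)) ->
  \int[mu]_(t in `[a, b]) f t = F b - F a.
Proof.
rewrite le_eqVlt => /predU1P[<- _ _|ab fc Ff].
  by rewrite set_itv1 Rintegral_set1 subrr.
rewrite /Rintegral (@continuous_FTC2 _ _ F)//.
- exact: continuous_subspaceT.
- exact: is_derive_oo_LRcontinuous.
- by rewrite (is_derive_derive1 Ff).
Qed.

Lemma Rintegral_shift (f : R -> R) a b (c : R) : a <= b -> continuous f ->
  \int[mu]_(t in `[a, b]) f (t + c) = \int[mu]_(t in `[a + c, b + c]) f t.
Proof.
move=> ab fc; rewrite /Rintegral.
have sd (x : R) : is_derive x (1 : R) (fun t : R => t + c) 1.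
  rewrite -[X in is_derive _ _ _ X]addr0.
  by apply: is_deriveD => //; exact: is_derive_cst.
have sd1 := is_derive_derive1 sd.
rewrite (@integration_by_substitution_increasing _ (fun t => t + c))// ?sd1.
- by congr fine; apply: eq_integral => t _ /=; rewrite mulr1.
- by move=> x y _ _; rewrite ltrD2r.
- by move=> x _; exact: cvg_cst.
- exact: is_cvg_cst.
- exact: is_cvg_cst.
- exact: (is_derive_oo_LRcontinuous _ _ sd).
- exact: continuous_subspaceT.
Qed.

Lemma Rintegral_opp (f : R -> R) a b : a <= b -> continuous f ->
  \int[mu]_(t in `[a, b]) f (- t) = \int[mu]_(t in `[- b, - a]) f t.
Proof.
move=> ab fc; rewrite /Rintegral integration_by_substitution_oppr//.
exact: continuous_subspaceT.
Qed.

Lemma continuous_integrable (f : R -> R) a b : continuous f ->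
  mu.-integrable `[a, b] (fun t => (f t)%:E).
Proof.
move=> fc; apply: continuous_compact_integrable; first exact: segment_compact.
exact: continuous_subspaceT.
Qed.

Lemma Rintegral_chasles (f : R -> R) a b (c : R) : a <= b -> b <= c ->
  mu.-integrable `[a, c] (fun t => (f t)%:E) ->
  \int[mu]_(t in `[a, c]) f t =
  \int[mu]_(t in `[a, b]) f t + \int[mu]_(t in `[b, c]) f t.
Proof.
move=> ab bc fi; apply/eqP; rewrite addrC -subr_eq; apply/eqP.
rewrite (Rintegral_itvB fi) ?bnd_simp//.
rewrite Rintegral_itv_obnd_cbnd//; apply: integrableS fi => //.
apply: subset_itv; rewrite ?bnd_simp//.
Qed.

Definition is_cderive (H h : R -> R[i]) := forall t : R,
  is_derive t (1 : R) (fun t => Re (H t)) (Re (h t)) /\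
  is_derive t (1 : R) (fun t => Im (H t)) (Im (h t)).

Lemma is_cderive_continuous H h : is_cderive H h -> ccontinuous H.
Proof.
move=> Hh; split; apply: is_derive_continuous => x; first by have [] := Hh x.
by have [] := Hh x.
Qed.

Lemma cintegral_FTC (H h : R -> R[i]) a b : a <= b -> ccontinuous h ->
  is_cderive H h -> cintegral_on `[a, b] h = H b - H a.
Proof.
move=> ab [h1 h2] Hh; apply: ceqP; rewrite (cReE, cImE) /= ?cReN ?cImN.
  exact: (Rintegral_FTC ab h1 (fun x => (Hh x).1)).
exact: (Rintegral_FTC ab h2 (fun x => (Hh x).2)).
Qed.

Lemma cintegral_shift h a b (c : R) : a <= b -> ccontinuous h ->
  cintegral_on `[a, b] (fun t => h (t + c)) = cintegral_on `[a + c, b + c] h.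
Proof.
move=> ab [h1 h2]; rewrite /cintegral_on.
rewrite (@Rintegral_shift (fun t => Re (h t)))//.
by rewrite (@Rintegral_shift (fun t => Im (h t))).
Qed.

Lemma cintegral_chasles h a b (c : R) : a <= b -> b <= c -> ccontinuous h ->
  cintegral_on `[a, c] h = cintegral_on `[a, b] h + cintegral_on `[b, c] h.
Proof.
move=> ab bc hc; have [h1 h2] := ccontinuous_integrable a c hc.
by rewrite /cintegral_on (Rintegral_chasles ab bc h1) (Rintegral_chasles ab bc h2).
Qed.

(** Folding pairs v with - v; in the inversion integral the two exponentials then add up to a
    cosine. *)
Lemma cintegral_reflect h (V : R) : 0 <= V -> ccontinuous h ->
  cintegral_on `[- V, V] h = cintegral_on `[0, V] (fun v => h v + h (- v)).
Proof.
move=> V0 hc; rewrite (@cintegral_chasles _ _ 0)// ?oppr_le0//.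
rewrite cintegral_onD//; last 2 first.
- exact: ccontinuous_integrable.
- apply: ccontinuous_integrable; apply: ccontinuous_comp => //.
  exact: opp_continuous.
rewrite addrC; congr (_ + _); have [h1 h2] := hc.
by rewrite /cintegral_on (@Rintegral_opp (fun t => Re (h t)))//
  (@Rintegral_opp (fun t => Im (h t)))// oppr0.
Qed.

Lemma is_cderiveM H h G g : is_cderive H h -> is_cderive G g ->
  is_cderive (fun t => H t * G t) (fun t => h t * G t + H t * g t).
Proof.
move=> Hh Gg t; have [h1 h2] := Hh t; have [g1 g2] := Gg t; split.
  under eq_fun do rewrite cReM.
  apply: (is_derive_eq (is_deriveB (is_deriveM h1 g1) (is_deriveM h2 g2))).
  by rewrite !cReE /GRing.scale/=; ring.
under eq_fun do rewrite cImM.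
apply: (is_derive_eq (is_deriveD (is_deriveM h1 g2) (is_deriveM h2 g1))).
by rewrite !cImE /GRing.scale/=; ring.
Qed.

Lemma is_derive_scale (c x : R) : is_derive x (1 : R) (fun t : R => c * t) c.
Proof.
have := is_deriveZ c (is_derive_id x (1 : R)).
by rewrite /GRing.scale/= mulr1.
Qed.

Lemma is_cderive_expj (c : R) :
  is_cderive (fun t => expj (c * t)) (fun t => (c *i) * expj (c * t)).
Proof.
move=> t; have cd := is_derive_scale c t; split => /=.
  apply: (is_derive_eq (is_derive1_comp (is_derive_cos (c * t)) cd)).
  by rewrite mul0r sub0r mulrC mulrN.
apply: (is_derive_eq (is_derive1_comp (is_derive_sin (c * t)) cd)).
by rewrite mul0r add0r mulrC.
Qed.

Lemma rcontinuous_scale (c : R) : continuous (fun t : R => c * t).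
Proof. by move=> t; apply: cvgM; [exact: cvg_cst|exact: cvg_id]. Qed.

Lemma rcontinuous_shift (c : R) : continuous (fun t : R => t + c).
Proof. by move=> t; apply: cvgD; [exact: cvg_id|exact: cvg_cst]. Qed.

Lemma ccontinuous_expj_scale (c : R) : ccontinuous (fun t => expj (c * t)).
Proof. by apply: ccontinuous_expj; exact: rcontinuous_scale. Qed.

Lemma cintegral_compact h (B : R) : (forall t, B < `|t| -> h t = 0) ->
  cintegral h = cintegral_on `[- B, B] h.
Proof.
move=> h0; apply: eq_cintegral_support => // t tB; apply: h0.
by rewrite ltNge ler_norml; apply/negP => ?; apply: tB; rewrite /= in_itv.
Qed.

Lemma cintegrable_compact h (B : R) : ccontinuous h ->
  (forall t, B < `|t| -> h t = 0) -> cintegrable h.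
Proof.
move=> hc h0; apply: (@cintegrable_support _ `[- B, B]) => //.
- move=> t tB; apply: h0.
  by rewrite ltNge ler_norml; apply/negP => ?; apply: tB; rewrite /= in_itv.
- exact: ccontinuous_integrable.
Qed.

Lemma cintegral_interval h a b : a <= b ->
  (forall t, ~~ (a <= t <= b) -> h t = 0) ->
  cintegral h = cintegral_on `[a, b] h.
Proof.
move=> ab h0; apply: eq_cintegral_support => // t tB; apply: h0.
by apply/negP => ?; apply: tB; rewrite /= in_itv.
Qed.

Lemma cintegral_shift_compact h (B c : R) : ccontinuous h ->
  (forall t, B < `|t| -> h t = 0) ->
  cintegral (fun t => h (t + c)) = cintegral h.
Proof.
(* A negative B forces h to vanish everywhere. *)
move=> hc h0; have [B0|B0] := ltP B 0.
  by congr cintegral; apply/funext => t; rewrite !h0// (lt_le_trans B0).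
have BB : - B <= B by rewrite (le_trans _ B0)// oppr_le0.
rewrite (cintegral_compact h0) (@cintegral_interval _ (- B - c) (B - c)).
- by rewrite cintegral_shift ?subrK//; rewrite lerD2r.
- by rewrite lerD2r.
- move=> t; rewrite lerBlDr lerBrDr => tB; apply: h0.
  by rewrite ltNge ler_norml.
Qed.

End intervals.

(** * Test functions and their Fourier transforms *)

Section smooth.
Variable R : realType.
Implicit Types (f g df dg : R -> R) (a b c : R).
Local Notation Re := (@complex.Re R).
Local Notation Im := (@complex.Im R).

(** Off by one from the usual C^n: this provides n + 1 derivatives. A fixed order allows induction
    on n for products, since (f g)' involves only products of functions that are one order less
    regular. *)
Definition Ck (n : nat) f :=
  forall k, (k <= n)%N -> forall t, derivable (derive1n k f) t 1.

Lemma smoothP f : smooth f <-> forall n, Ck n f.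
Proof. by split=> [fs n k _|fs n]; [exact: fs|exact: (fs n)]. Qed.

Lemma Ck_is_derive n f : Ck n f -> forall x : R, is_derive x (1 : R) f (derive1 f x).
Proof.
by move=> /(_ 0%N isT) fd x; rewrite derive1E; apply/derivableP; exact: fd.
Qed.

Lemma Ck_derive n f : Ck n.+1 f -> Ck n (derive1 f).
Proof. by move=> fs k kn t; rewrite -derive1Sn; exact: fs. Qed.

Lemma Ck_leS n f : Ck n.+1 f -> Ck n f.
Proof. by move=> fs k kn; apply: fs; exact: leqW. Qed.

Lemma is_derive_Ck0 f df : (forall x : R, is_derive x (1 : R) f (df x)) -> Ck 0 f.
Proof.
by move=> fd [|//] _ t; apply: ex_derive; exact: fd.
Qed.

Lemma is_derive_CkS n f df : (forall x : R, is_derive x (1 : R) f (df x)) ->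
  Ck n df -> Ck n.+1 f.
Proof.
move=> fd dfn [|k] kn t; first by apply: ex_derive; exact: fd.
by rewrite derive1Sn (is_derive_derive1 fd); exact: dfn.
Qed.

Lemma CkD n f g : Ck n f -> Ck n g -> Ck n (fun t => f t + g t).
Proof.
elim: n f g => [|n IH] f g fn gn; have fd := Ck_is_derive fn;
  have gd := Ck_is_derive gn.
  by apply: is_derive_Ck0 => x; exact: is_deriveD.
apply: (is_derive_CkS (fun x => is_deriveD (fd x) (gd x))).
exact: (IH _ _ (Ck_derive fn) (Ck_derive gn)).
Qed.

Lemma CkM n f g : Ck n f -> Ck n g -> Ck n (fun t => f t * g t).
Proof.
elim: n f g => [|n IH] f g fn gn; have fd := Ck_is_derive fn;
  have gd := Ck_is_derive gn.
  by apply: is_derive_Ck0 => x; exact: is_deriveM.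
apply: (is_derive_CkS (fun x => is_deriveM (fd x) (gd x))).
exact: (CkD (IH _ _ (Ck_leS fn) (Ck_derive gn)) (IH _ _ (Ck_leS gn) (Ck_derive fn))).
Qed.

Lemma Ck_cst n a : Ck n (fun=> a).
Proof.
elim: n a => [|n IH] a; first by apply: is_derive_Ck0 => x; exact: is_derive_cst.
exact: (is_derive_CkS (fun x => is_derive_cst a x 1) (IH 0)).
Qed.

Lemma Ck_shift n f a : Ck n f -> Ck n (fun t => f (t + a)).
Proof.
have shd (x : R) : is_derive x (1 : R) (fun t : R => t + a) 1.
  rewrite -[X in is_derive _ _ _ X]addr0.
  by apply: is_deriveD => //; exact: is_derive_cst.
have shf g : (forall x : R, is_derive x (1 : R) g (derive1 g x)) ->
    forall x : R, is_derive x (1 : R) (fun t => g (t + a)) (derive1 g (x + a)).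
  move=> gd x; apply: (is_derive_eq (@is_derive1_comp _ g (fun t => t + a) x _ _ (gd (x + a)) (shd x))).
  by rewrite mulr1.
elim: n f => [|n IH] f fn; first exact: (is_derive_Ck0 (shf _ (Ck_is_derive fn))).
exact: (is_derive_CkS (shf _ (Ck_is_derive fn)) (IH _ (Ck_derive fn))).
Qed.

Lemma Ck_id n : Ck n (fun t => t).
Proof.
have h (x : R) := is_derive_id x (1 : R).
case: n => [|n]; first by apply: (is_derive_Ck0 h).
exact: (@is_derive_CkS n (fun t => t) (fun=> 1) h (@Ck_cst n 1)).
Qed.

Lemma Ck_sincos n c : Ck n (fun t => sin (c * t)) /\ Ck n (fun t => cos (c * t)).
Proof.
have sd (x : R) : is_derive x (1 : R) (fun t => sin (c * t)) (c * cos (c * x)).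
  apply: (is_derive_eq (is_derive1_comp (is_derive_sin _) (is_derive_scale c x))).
  by rewrite mulrC.
have cd (x : R) : is_derive x (1 : R) (fun t => cos (c * t)) ((- c) * sin (c * x)).
  apply: (is_derive_eq (is_derive1_comp (is_derive_cos _) (is_derive_scale c x))).
  by rewrite !mulNr mulrC.
elim: n => [|n [IHs IHc]].
  by split; [exact: (is_derive_Ck0 sd)|exact: (is_derive_Ck0 cd)].
split; first exact: (is_derive_CkS sd (CkM (@Ck_cst n c) IHc)).
exact: (is_derive_CkS cd (CkM (@Ck_cst n (- c)) IHs)).
Qed.

Definition csmooth (h : R -> R[i]) :=
  smooth (fun t => Re (h t)) /\ smooth (fun t => Im (h t)).

Lemma csmooth_cst (z : R[i]) : csmooth (fun=> z).
Proof. by split; apply/smoothP => n; [exact: (@Ck_cst n (Re z))|exact: (@Ck_cst n (Im z))]. Qed.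

Lemma csmoothD (h g : R -> R[i]) : csmooth h -> csmooth g -> csmooth (fun t => h t + g t).
Proof.
move=> [/smoothP h1 /smoothP h2] [/smoothP g1 /smoothP g2].
split; under eq_fun do rewrite (cReE, cImE); apply/smoothP => n; exact: CkD.
Qed.

Lemma csmoothM (h g : R -> R[i]) : csmooth h -> csmooth g -> csmooth (fun t => h t * g t).
Proof.
move=> [/smoothP h1 /smoothP h2] [/smoothP g1 /smoothP g2].
split; apply/smoothP => n.
  under eq_fun do rewrite cReM -mulN1r.
  exact: (CkD (CkM (h1 n) (g1 n)) (CkM (@Ck_cst n (- 1)) (CkM (h2 n) (g2 n)))).
under eq_fun do rewrite cImM.
exact: (CkD (CkM (h1 n) (g2 n)) (CkM (h2 n) (g1 n))).
Qed.

Lemma csmooth_shift h a : csmooth h -> csmooth (fun t => h (t + a)).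
Proof.
move=> [/smoothP h1 /smoothP h2].
split; apply/smoothP => n; first exact: (@Ck_shift _ (fun t => Re (h t))).
exact: (@Ck_shift _ (fun t => Im (h t))).
Qed.

Lemma csmooth_expj c : csmooth (fun t => expj (c * t)).
Proof. by split; apply/smoothP => n; have [] := Ck_sincos n c. Qed.

Lemma csmooth_real f : smooth f -> csmooth (fun t => (f t)%:C).
Proof. by move=> fs; split=> [|]; [exact: fs|]; apply/smoothP => n; exact: (@Ck_cst n 0). Qed.

Lemma csmooth_id : csmooth (fun t => t%:C).
Proof. by apply: csmooth_real; apply/smoothP => n; exact: Ck_id. Qed.

Definition cderive (h : R -> R[i]) (t : R) : R[i] :=
  derive1 (fun t => Re (h t)) t +i* derive1 (fun t => Im (h t)) t.

Lemma csmooth_cderive h : csmooth h -> csmooth (cderive h).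
Proof.
by move=> [h1 h2]; split => n t; rewrite -derive1Sn; [exact: (h1 n.+1)|exact: (h2 n.+1)].
Qed.

Lemma csmooth_is_cderive h : csmooth h -> is_cderive h (cderive h).
Proof.
move=> [/smoothP h1 /smoothP h2] t.
by split; [exact: (Ck_is_derive (h1 0%N))|exact: (Ck_is_derive (h2 0%N))].
Qed.

Lemma csmooth_ccontinuous h : csmooth h -> ccontinuous h.
Proof. by move/csmooth_is_cderive/is_cderive_continuous. Qed.

Lemma cderive_support h (B : R) : (forall t, B < `|t| -> h t = 0) ->
  forall t, B < `|t| -> cderive h t = 0.
Proof.
move=> h0 t Bt; have nBt : \forall s \near t, B < `|s|.
  exact: (cvgr_gt _ (@norm_continuous _ _ t)).
rewrite /cderive !derive1E.
have -> : (0 : R[i]) = 0 +i* 0 by [].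
congr (_ +i* _).
  rewrite (near_eq_derive (1 : R) (g := cst 0)) ?derive_cst//.
  by near=> s => /=; rewrite h0//; near: s.
rewrite (near_eq_derive (1 : R) (g := cst 0)) ?derive_cst//.
by near=> s => /=; rewrite h0//; near: s.
Unshelve. all: by end_near. Qed.

Lemma test_functionP (phi : R -> R[i]) : test_function phi <->
  csmooth phi /\ exists B : R, forall t, B < `|t| -> phi t = 0.
Proof. by split=> [[]|[[]]]. Qed.

Lemma test_functionM (h : R -> R[i]) (phi : R -> R[i]) : csmooth h -> test_function phi ->
  test_function (fun t => h t * phi t).
Proof.
move=> hs /test_functionP[ps [B pB]]; apply/test_functionP; split.
  exact: csmoothM.
by exists B => t /pB ->; rewrite mulr0.
Qed.

Lemma test_functionD (phi : R -> R[i]) (psi : R -> R[i]) : test_function phi -> test_function psi ->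
  test_function (fun t => phi t + psi t).
Proof.
move=> /test_functionP[ps [B pB]] /test_functionP[qs [C qC]].
apply/test_functionP; split; first exact: csmoothD.
by exists (Num.max B C) => t; rewrite gt_max => /andP[/pB -> /qC ->]; rewrite addr0.
Qed.

Lemma test_functionZ (z : R[i]) (phi : R -> R[i]) : test_function phi ->
  test_function (fun t => z * phi t).
Proof. by apply: test_functionM; exact: csmooth_cst. Qed.

Lemma test_function_shift (phi : R -> R[i]) a : test_function phi ->
  test_function (fun t => phi (t + a)).
Proof.
move=> /test_functionP[ps [B pB]]; apply/test_functionP; split.
  exact: csmooth_shift.
exists (B + `|a|) => t Bt; apply: pB.
by have := ler_normB (t + a) a; rewrite addrK; lra.
Qed.

Lemma test_function_cderive (phi : R -> R[i]) : test_function phi ->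
  test_function (cderive phi).
Proof.
move=> /test_functionP[ps [B pB]]; apply/test_functionP; split.
  exact: csmooth_cderive.
by exists B; exact: cderive_support.
Qed.

End smooth.

(** * Fourier transforms: regularity, operations and rapid decay *)

Section fourier.
Variable R : realType.
Implicit Types (h phi psi : R -> R[i]) (z : R[i]) (a b c v f : R).
Local Notation Re := (@complex.Re R).
Local Notation Im := (@complex.Im R).
Local Notation mu := (@lebesgue_measure R).

Lemma real_complexM (a b : R) : (a * b)%:C = a%:C * b%:C.
Proof. by apply: ceqP => /=; ring. Qed.

(** The choice c = - 2 pi is the Fourier transform and c = 2 pi its inverse, so that both share the
    same bounds. *)
Definition osc (c : R) (h : R -> R[i]) (v : R) : R[i] :=
  cintegral (fun t => h t * expj (c * v * t)).

Lemma fourier_funE phi f : fourier_fun phi f = osc (- (2 * pi)) phi f.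
Proof.
by congr cintegral; apply/funext => t; rewrite !mulNr.
Qed.

Lemma cintegrable_expj h c : cintegrable h ->
  cintegrable (fun t => h t * expj (c * t)).
Proof.
move=> hi; under eq_fun do rewrite mulrC.
apply: (@cintegrable_onM _ setT _ _ 2) => //; last by move=> t _; exact: cabs_expj.
by apply: ccontinuous_cmeasurable => //; exact: ccontinuous_expj_scale.
Qed.

Lemma osc_bound c h : cintegrable h -> exists C : R, forall v, cabs (osc c h v) <= C.
Proof.
move=> hi; exists (\int[mu]_t (2 * cabs (h t))) => v.
rewrite /osc cintegral_onT; apply: le_cintegral_on => //.
- exact: cintegrable_expj.
- by apply: integrable_onZl => //; exact: cintegrable_on_cabs.
- move=> t _; rewrite mulrC; apply: (le_trans (cabsM _ _)).
  by apply: ler_wpM2r; [exact: cabs_ge0|exact: cabs_expj].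
Qed.

(** The exponential is 2 |c t|-Lipschitz in the frequency, so the first moment of h provides the
    constant. *)
Lemma osc_lipschitz c h : cintegrable h -> cintegrable (fun t => t%:C * h t) ->
  exists C : R, forall v w, cabs (osc c h v - osc c h w) <= C * `|v - w|.
Proof.
move=> hi thi; exists (\int[mu]_t (2 * `|c| * cabs (t%:C * h t))) => v w.
have ti : mu.-integrable setT (fun t => (2 * `|c| * cabs (t%:C * h t))%:E).
  by apply: integrable_onZl => //; exact: cintegrable_on_cabs.
rewrite /osc !cintegral_onT -cintegral_onB//; [|exact: cintegrable_expj..].
rewrite -RintegralZr//.
apply: le_cintegral_on => //.
- by apply: cintegrable_onB => //; exact: cintegrable_expj.
- by under eq_fun do rewrite mulrC; exact: integrable_onZl.
- move=> t _; rewrite -mulrBr; apply: (le_trans (cabsM _ _)).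
  have -> : cabs (t%:C * h t) = `|t| * cabs (h t).
    by rewrite /cabs cReM cImM /= !mul0r subr0 addr0 !normrM mulrDr.
  have := cabs_expjB (c * v * t) (c * w * t).
  rewrite -mulrBl -mulrBr !normrM => H.
  apply: (le_trans (ler_wpM2l (cabs_ge0 _) H)).
  by rewrite le_eqVlt; apply/orP; left; apply/eqP; ring.
Qed.

Lemma lipschitz_ccontinuous h (C : R) :
  (forall v w, cabs (h v - h w) <= C * `|v - w|) -> ccontinuous h.
Proof.
have H (f : R -> R) : (forall v w, `|f v - f w| <= C * `|v - w|) -> continuous f.
  move=> fC x; apply/cvgrPdist_le => e e0.
  have C0 : 0 < `|C| + 1 by rewrite ltr_wpDl.
  near=> t; apply: (le_trans (fC _ _)).
  apply: (@le_trans _ _ ((`|C| + 1) * `|x - t|)).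
    by apply: ler_wpM2r => //; rewrite (le_trans (ler_norm _))// lerDl.
  rewrite mulrC -ler_pdivlMr//; near: t.
  by apply: cvgr_dist_le; [exact: cvg_id|exact: divr_gt0].
move=> hC; split; apply: H => v w; apply: le_trans (hC v w).
  by have := cabs_Re (h v - h w); rewrite cReD cReN.
by have := cabs_Im (h v - h w); rewrite cImD cImN.
Unshelve. all: by end_near. Qed.

Lemma osc_ccontinuous c h : cintegrable h -> cintegrable (fun t => t%:C * h t) ->
  ccontinuous (osc c h).
Proof.
by move=> hi thi; have [C hC] := osc_lipschitz c hi thi; exact: lipschitz_ccontinuous hC.
Qed.

Lemma rcontinuous_id : continuous (fun t : R => t). Proof. by move=> t; exact: cvg_id. Qed.

Definition compactly_supported h := exists B : R, forall t, B < `|t| -> h t = 0.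

Lemma cs_cintegrable h : ccontinuous h -> compactly_supported h -> cintegrable h.
Proof. by move=> hc [B hB]; exact: cintegrable_compact hB. Qed.

Lemma cs_mulr h u : compactly_supported h ->
  compactly_supported (fun t => u t * h t).
Proof. by move=> [B hB]; exists B => t /hB ->; rewrite mulr0. Qed.

Lemma ccontinuous_id : ccontinuous (fun t : R => t%:C).
Proof. by apply: ccontinuous_C; exact: rcontinuous_id. Qed.

Lemma cs_cintegrable_id h : ccontinuous h -> compactly_supported h ->
  cintegrable (fun t => t%:C * h t).
Proof.
move=> hc hs; apply: cs_cintegrable; last exact: cs_mulr.
by apply: ccontinuousM => //; exact: ccontinuous_id.
Qed.

Lemma fourier_shift phi v f : ccontinuous phi -> compactly_supported phi ->
  fourier_fun (fun t => phi (t + v)) f =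
  expj (2 * pi * v * f) * fourier_fun phi f.
Proof.
move=> pc [B pB]; rewrite !fourier_funE /osc.
have ec : ccontinuous (fun t => phi t * expj (- (2 * pi) * f * t)).
  by apply: ccontinuousM => //; exact: ccontinuous_expj_scale.
have e0 t : B < `|t| -> phi t * expj (- (2 * pi) * f * t) = 0.
  by move=> /pB ->; rewrite mul0r.
rewrite -(cintegral_shift_compact v ec e0) !cintegral_onT -cintegral_onZ//.
  apply: eq_cintegral_on => t _; rewrite mulrCA -expjD; congr (_ * expj _).
  by ring.
apply: (@cintegrable_compact _ _ (B + `|v|)).
  exact: (ccontinuous_comp ec (@rcontinuous_shift R v)).
move=> t Bt; apply: e0; have := ler_normB (t + v) v; rewrite addrK; lra.
Qed.

Lemma fourierZ z phi f : cintegrable phi ->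
  fourier_fun (fun t => z * phi t) f = z * fourier_fun phi f.
Proof.
move=> pI; rewrite !fourier_funE /osc !cintegral_onT -cintegral_onZ//.
  by apply: eq_cintegral_on => t _; rewrite mulrA.
exact: cintegrable_expj.
Qed.

Lemma fourierD phi psi f : cintegrable phi -> cintegrable psi ->
  fourier_fun (fun t => phi t + psi t) f = fourier_fun phi f + fourier_fun psi f.
Proof.
move=> pI qI; rewrite !fourier_funE /osc !cintegral_onT -cintegral_onD//.
  by apply: eq_cintegral_on => t _; rewrite mulrDl.
all: exact: cintegrable_expj.
Qed.

Lemma fourier_modulate phi s f :
  fourier_fun (fun t => expj (- (2 * pi * t * s)) * phi t) f = fourier_fun phi (f + s).
Proof.
congr cintegral; apply/funext => t.
by rewrite [expj _ * _]mulrC -[LHS]mulrA -expjD; congr (_ * expj _); ring.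
Qed.

Lemma test_function_ccontinuous phi : test_function phi -> ccontinuous phi.
Proof. by move=> /test_functionP[/csmooth_ccontinuous]. Qed.

Lemma test_function_cs phi : test_function phi -> compactly_supported phi.
Proof. by move=> /test_functionP[]. Qed.

Lemma test_function_cintegrable phi : test_function phi -> cintegrable phi.
Proof.
by move=> pt; apply: cs_cintegrable; [exact: test_function_ccontinuous|exact: test_function_cs].
Qed.

(** Integration by parts: the fundamental theorem is applied to phi times the exponential. *)
Lemma fourier_cderive phi f : test_function phi ->
  fourier_fun (cderive phi) f = ((2 * pi * f) *i) * fourier_fun phi f.
Proof.
move=> pt; have [ps [B0 pB0]] := (test_functionP phi).1 pt.
(* With B nonnegative, the endpoints of [- (B + 1), B + 1] lie strictly where phi vanishes, so no
   boundary term remains. *)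
pose B := Num.max B0 0.
have pB t : B < `|t| -> phi t = 0.
  by rewrite /B gt_max => /andP[/pB0].
have BB : - (B + 1) <= B + 1 by rewrite /B; case: (leP B0 0); lra.
have dt := test_function_cderive pt.
pose e t : R[i] := expj ((- (2 * pi) * f) * t).
have ec : ccontinuous e by exact: ccontinuous_expj_scale.
have ed : is_cderive e (fun t => ((- (2 * pi) * f) *i) * e t) by exact: is_cderive_expj.
have pd := is_cderiveM (csmooth_is_cderive ps) ed.
have cc : ccontinuous (fun t => cderive phi t * e t + phi t * (((- (2 * pi) * f) *i) * e t)).
  apply: ccontinuousD; apply: ccontinuousM => //.
  - exact: test_function_ccontinuous.
  - exact: test_function_ccontinuous.
  - by apply: ccontinuousM => //; exact: ccontinuous_cst.
have supp : forall t, B + 1 < `|t| ->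
    cderive phi t * e t + phi t * (((- (2 * pi) * f) *i) * e t) = 0.
  move=> t Bt; have {}Bt : B < `|t| by lra.
  by rewrite pB// (cderive_support pB)// !mul0r addr0.
have := cintegral_FTC BB cc pd; rewrite -(cintegral_compact supp).
rewrite !pB; last 2 first.
- by rewrite normrN ger0_norm; rewrite /B; case: (leP B0 0); lra.
- by rewrite ger0_norm; rewrite /B; case: (leP B0 0); lra.
rewrite !mul0r subrr cintegral_onT.
have -> : (fun t => cderive phi t * e t + phi t * (((- (2 * pi) * f) *i) * e t)) =
    (fun t => cderive phi t * e t + ((- (2 * pi) * f) *i) * (phi t * e t)).
  by apply/funext => t; congr (_ + _); rewrite mulrCA.
have dI : cintegrable (fun t => cderive phi t * e t).
  by apply: cintegrable_expj; exact: test_function_cintegrable.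
have pI : cintegrable (fun t => phi t * e t).
  by apply: cintegrable_expj; exact: test_function_cintegrable.
rewrite cintegral_onD ?cintegral_onZ//; last exact: cintegrable_onZ.
rewrite !fourier_funE /osc !cintegral_onT => /eqP.
rewrite addr_eq0 => /eqP ->; rewrite -mulNr; congr (_ * _).
by apply: ceqP => /=; rewrite ?oppr0//; ring.
Qed.

(* The Fourier transform turns this operator into multiplication by 1 + f^2. *)
Definition bessel_op phi t : R[i] :=
  phi t + (- ((2 * pi) ^- 2))%:C * cderive (cderive phi) t.

Lemma test_function_bessel phi : test_function phi -> test_function (bessel_op phi).
Proof.
move=> pt; apply: test_functionD => //; apply: test_functionZ.
by do 2 apply: test_function_cderive.
Qed.

Lemma fourier_bessel phi f : test_function phi ->
  fourier_fun (bessel_op phi) f = (1 + f ^+ 2)%:C * fourier_fun phi f.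
Proof.
move=> pt; have dt := test_function_cderive pt; have ddt := test_function_cderive dt.
rewrite fourierD; [|exact: test_function_cintegrable|]; last first.
  by apply: test_function_cintegrable; exact: test_functionZ.
rewrite fourierZ; last exact: test_function_cintegrable.
rewrite !fourier_cderive// !mulrA -{1}[fourier_fun phi f]mul1r -mulrDl.
congr (_ * _); have p0 : pi != 0 :> R by rewrite gt_eqF// pi_gt0.
by move: (pi : R) p0 => p p0; apply: ceqP => /=; field.
Qed.

(** Each application of [bessel_op] gains one factor 1 + f^2; the base case is boundedness of the
    transform of an integrable function. *)
Lemma fourier_rapid (m : nat) phi : test_function phi ->
  exists C : R, forall f, cabs (((1 + f ^+ 2) ^+ m)%:C * fourier_fun phi f) <= C.
Proof.
elim: m phi => [|m IH] phi pt.
  have [C HC] := osc_bound (- (2 * pi)) (test_function_cintegrable pt).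
  by exists C => f; rewrite expr0 mul1r fourier_funE.
have [C HC] := IH _ (test_function_bessel pt).
exists C => f; have := HC f; rewrite fourier_bessel// mulrA.
by rewrite [(1 + f ^+ 2) ^+ m.+1]exprSr real_complexM.
Qed.

Lemma fourier_fun_ccontinuous phi : ccontinuous phi -> compactly_supported phi ->
  ccontinuous (fourier_fun phi).
Proof.
move=> pc ps; have -> : fourier_fun phi = osc (- (2 * pi)) phi.
  by apply/funext => f; rewrite fourier_funE.
by apply: osc_ccontinuous; [exact: cs_cintegrable|exact: cs_cintegrable_id].
Qed.

End fourier.

(** * Fourier inversion *)

Section fubini_interval.
Variable R : realType.
Local Notation mu := (@lebesgue_measure R).
Local Notation mR := (measurableTypeR R).

(** Since k is bounded and v ranges over a bounded interval, the integral of |h k| is at most M (b -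
    a) times that of |h|. The indicator [I] extends the inner variable to the whole line, where
    Fubini's theorem is applied. *)
Lemma Rintegral_fubini_bounded (h : R -> R) (k : mR * mR -> R) (M a b : R) :
  a <= b -> mu.-integrable setT (fun x => (h x)%:E) ->
  measurable_fun setT k -> (forall p, `|k p| <= M) ->
  \int[mu]_(v in `[a, b]) (\int[mu]_x (h x * k (x, v))) =
  \int[mu]_x (h x * \int[mu]_(v in `[a, b]) k (x, v)).
Proof.
move=> ab hi km kM.
have hm : measurable_fun setT h by apply/measurable_EFinP; exact: measurable_int hi.
have M0 : 0 <= M by apply: le_trans (kM (0, 0)).
pose I : mR -> R := \1_(`[a, b]).
pose f (p : mR * mR) : R := h p.1 * k p * I p.2.
have Im : measurable_fun setT I by exact: measurable_indic.
have fm : measurable_fun setT f.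
  apply: measurable_funM; last exact: measurableT_comp.
  by apply: measurable_funM => //; exact: measurableT_comp.
have iI : mu.-integrable setT (fun v => (I v)%:E).
  exact: integrable_indic_itv.
have fi : (mu \x mu)%E.-integrable setT (EFin \o f).
  apply/integrable12ltyP; first exact/measurable_EFinP.
  have inner x : (\int[mu]_y `|(EFin \o f) (x, y)| <=
     (`|h x| * (M * (b - a)))%:E)%E.
    apply: (@le_trans _ _ (\int[mu]_y (`|h x| * M * I y)%:E)%E).
      apply: ge0_le_integral => //.
      - by apply/measurable_EFinP; apply: measurableT_comp => //; exact: (measurableT_comp fm).
      - by apply/measurable_EFinP; apply: measurable_funM => //.
      - move=> y _ /=; rewrite lee_fin /f /= !normrM (ger0_norm (_ : 0 <= I y)).
          apply: ler_wpM2r; first by rewrite /I indicE.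
          by apply: ler_wpM2l.
        by rewrite /I indicE.
    under eq_integral do rewrite EFinM.
    rewrite integralZl// /I integral_indic// setIT.
    rewrite [X in (_ * X <= _)%E](_ : _ = (b - a)%:E).
      by rewrite -EFinM mulrA.
    transitivity (lebesgue_measure (`[a, b] : set R)); first by [].
    rewrite lebesgue_measure_itv/= lte_fin; case: ltP => // ba.
    by have /eqP -> : a == b; rewrite ?eq_le ?ab// subrr.
  apply: (@le_lt_trans _ _ (\int[mu]_x (`|h x| * (M * (b - a)))%:E)%E).
    apply: ge0_le_integral => //.
    - by move=> x _; exact: integral_ge0.
    - apply: (measurable_fun_fubini_tonelli_F (fun p => `|(f p)%:E|)%E) => //.
      by apply: measurableT_comp => //; exact/measurable_EFinP.
    - by apply/measurable_EFinP; apply: measurable_funM => //; exact: measurableT_comp.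
  have /integrableP[_] : mu.-integrable setT (fun x => (`|h x| * (M * (b - a)))%:E).
    under eq_fun do rewrite mulrC.
    under eq_fun do rewrite EFinM.
    by apply: integrableZl => //; exact: (integrable_norm hi).
  apply: le_lt_trans; apply: ge0_le_integral => //.
  - by move=> x _; rewrite lee_fin !mulr_ge0// subr_ge0.
  - by apply/measurable_EFinP; apply: measurable_funM => //; exact: measurableT_comp.
  - apply: measurableT_comp => //.
    by apply/measurable_EFinP; apply: measurable_funM => //; exact: measurableT_comp.
  - by move=> x _; rewrite lee_fin ler_norm.
have := Fubini fi.
rewrite /Rintegral.
have -> : (\int[mu]_x \int[mu]_y (EFin \o f) (x, y) =
   \int[mu]_x (h x * fine (\int[mu]_(v in `[a, b]) (k (x, v))%:E))%:E)%E.
  apply: eq_integral => x _ /=.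
  have ki : mu.-integrable `[a, b] (fun v => (k (x, v))%:E).
    apply: (@le_integrable _ _ _ mu `[a, b] _ _ (fun=> M%:E)) => //.
    - apply/measurable_EFinP; apply: measurable_funTS.
      exact: (measurableT_comp km).
    - by move=> v _; rewrite /= lee_fin (le_trans (kM _))// ler_norm.
    - by apply: continuous_integrable => t; exact: cvg_cst.
  rewrite EFinM fineK; last exact: integrable_fin_num.
  rewrite -integralZl// [RHS]integral_mkcond; apply: eq_integral => v _.
  rewrite /f /I /= patchE indicE; case: ifPn => /= _; first by rewrite mulr1.
  by rewrite mulr0.
move=> ->; congr fine; rewrite [LHS]integral_mkcond; apply: eq_integral => v _.
rewrite patchE; case: ifPn => vab; last first.
  rewrite /= (eq_integral (cst 0%E)) ?integral0// => x _.
  by rewrite /f /= /I indicE (negbTE vab) mulr0.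
rewrite fineK.
  by apply: eq_integral => x _; rewrite /f /I /= indicE vab mulr1.
apply: integrable_fin_num => //.
apply: (@le_integrable _ _ _ mu setT _ _ (fun x => (M * h x)%:E)) => //.
- apply/measurable_EFinP; apply: measurable_funM => //; exact: (measurableT_comp km).
- move=> x _ /=; rewrite lee_fin !normrM mulrC; apply: ler_wpM2r => //.
  by rewrite (le_trans (kM _))// ler_norm.
- exact: integrable_onZl.
Qed.
End fubini_interval.

(** * The Poisson kernel as an approximate identity *)

Section poisson_kernel.
Variable R : realType.
Local Notation mu := (@lebesgue_measure R).
Implicit Types (h : R -> R) (t e w V L : R).

Lemma expR_scale_derive e (v : R) :
  is_derive v (1 : R) (fun v => expR (e * v)) (e * expR (e * v)).
Proof.
apply: (is_derive_eq (@is_derive1_comp _ expR (fun v => e * v) v _ _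
  (is_derive_expR _) (is_derive_scale e v))).
by rewrite mulrC.
Qed.

Lemma sin_scale_derive w (v : R) :
  is_derive v (1 : R) (fun v => sin (w * v)) (w * cos (w * v)).
Proof.
apply: (is_derive_eq (@is_derive1_comp _ sin (fun v => w * v) v _ _
  (is_derive_sin _) (is_derive_scale w v))).
by rewrite mulrC.
Qed.

Lemma cos_scale_derive w (v : R) :
  is_derive v (1 : R) (fun v => cos (w * v)) (- w * sin (w * v)).
Proof.
apply: (is_derive_eq (@is_derive1_comp _ cos (fun v => w * v) v _ _
  (is_derive_cos _) (is_derive_scale w v))).
by rewrite !mulNr mulrC.
Qed.

Lemma continuous_expR_scale e : continuous (fun v : R => expR (e * v)).
Proof. exact: (is_derive_continuous (expR_scale_derive e)). Qed.
Lemma continuous_cos_scale e : continuous (fun v : R => cos (e * v)).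
Proof. exact: (is_derive_continuous (cos_scale_derive e)). Qed.
Lemma Rintegral_damped_cos e w V : 0 < e -> 0 <= V ->
  \int[mu]_(v in `[0, V]) (expR (- e * v) * cos (w * v)) =
  (e + expR (- e * V) * (w * sin (w * V) - e * cos (w * V))) / (e ^+ 2 + w ^+ 2).
Proof.
move=> e0 V0; have D0 : e ^+ 2 + w ^+ 2 != 0.
  by rewrite gt_eqF// ltr_wpDr ?exprn_gt0// sqr_ge0.
(* Real part of exp((- e + i w) v) / (- e + i w). *)
pose F (v : R) := (e ^+ 2 + w ^+ 2)^-1 *
  (expR (- e * v) * (w * sin (w * v) + (- e) * cos (w * v))).
have Fc : continuous (fun v => expR (- e * v) * cos (w * v)).
  move=> v; exact: (continuousM (@continuous_expR_scale (- e) v) (@continuous_cos_scale w v)).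
have Fd (v : R) : is_derive v (1 : R) F (expR (- e * v) * cos (w * v)).
  have d := is_deriveZ (e ^+ 2 + w ^+ 2)^-1 (is_deriveM (expR_scale_derive (- e) v)
    (is_deriveD (is_deriveZ w (sin_scale_derive w v))
      (is_deriveZ (- e) (cos_scale_derive w v)))).
  apply: (is_derive_eq d); rewrite !fctE /GRing.scale /= /GRing.scale /=.
  by field.
rewrite (Rintegral_FTC V0 Fc Fd) /F !mulr0 expR0 sin0 cos0.
by field.
Qed.

(** The bound must be uniform in w, because w will be 2 pi (a - t) with a ranging over the line;
    (|w| + e) e <= 2 (e^2 + w^2) removes w. *)
Lemma poisson_kernel_tail e w V : 0 < e -> 0 <= V ->
  `| \int[mu]_(v in `[0, V]) (expR (- e * v) * cos (w * v))
     - e / (e ^+ 2 + w ^+ 2) | <= expR (- e * V) * (2 / e).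
Proof.
move=> e0 V0; rewrite Rintegral_damped_cos//.
have D0 : 0 < e ^+ 2 + w ^+ 2 by rewrite ltr_wpDr ?exprn_gt0// sqr_ge0.
rewrite -mulrBl addrAC subrr add0r -mulrA normrM ger0_norm ?expR_ge0//.
apply: ler_wpM2l; first exact: expR_ge0.
rewrite normrM [X in _ * X]gtr0_norm ?invr_gt0// ler_pdivrMr// mulrAC ler_pdivlMr//.
apply: (@le_trans _ _ ((`|w| + e) * e)).
  apply: ler_wpM2r; first exact: ltW.
  apply: (le_trans (ler_normB _ _)); rewrite !normrM (gtr0_norm e0); apply: lerD.
    by rewrite ler_piMr// ler_norml sin_geN1 sin_le1.
  by rewrite ler_piMr ?(ltW e0)// ler_norml cos_geN1 cos_le1.
rewrite -(real_normK (num_real w)); have := sqr_ge0 (`|w| - e); nra.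
Qed.

(** The Fourier transform of exp(- e |v|) at the frequency y; its total mass is 1. *)
Definition poisson e (y : R) : R := 2 * e / (e ^+ 2 + (2 * pi * y) ^+ 2).

Lemma poisson_den_gt0 e (y : R) : 0 < e -> 0 < e ^+ 2 + (2 * pi * y) ^+ 2.
Proof. by move=> e0; rewrite ltr_wpDr ?exprn_gt0// sqr_ge0. Qed.

Lemma poisson_ge0 e (y : R) : 0 < e -> 0 <= poisson e y.
Proof.
move=> e0; rewrite /poisson divr_ge0 ?(ltW (poisson_den_gt0 _ e0))//.
by rewrite mulr_ge0// ltW.
Qed.

Lemma continuous_poisson e t : 0 < e -> continuous (fun a => poisson e (a - t)).
Proof.
move=> e0 a; apply: cvgM; first exact: cvg_cst.
apply: (@continuousV _ _ (fun a : R => e ^+ 2 + (2 * pi * (a - t)) ^+ 2)).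
  exact: lt0r_neq0 (poisson_den_gt0 _ e0).
apply: cvgD; first exact: cvg_cst.
apply: (@continuous_comp _ _ _ (fun a => 2 * pi * (a - t)) (fun y => y ^+ 2)).
  by apply: cvgM; [exact: cvg_cst|apply: cvgB; [exact: cvg_id|exact: cvg_cst]].
exact: exprn_continuous.
Qed.

Lemma poisson_le e (y : R) : 0 < e -> poisson e y <= 2 / e.
Proof.
move=> e0; rewrite /poisson ler_pdivrMr ?poisson_den_gt0// mulrAC ler_pdivlMr//.
have := sqr_ge0 (2 * pi * y); nra.
Qed.

Lemma Rintegral_poisson e t (d : R) : 0 < e -> 0 <= d ->
  \int[mu]_(a in `[t - d, t + d]) poisson e (a - t) =
  2 / pi * atan (2 * pi * d / e).
Proof.
move=> e0 d0; have p0 : 0 < pi :> R by exact: pi_gt0.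
pose F (a : R) := pi^-1 * atan ((2 * pi / e) * (a + - t)).
have sd (x : R) : is_derive x (1 : R) (fun a : R => a + - t) 1.
  rewrite -[X in is_derive _ _ _ X]addr0.
  by apply: is_deriveD => //; exact: is_derive_cst.
have ad (y : R) : is_derive y (1 : R) atan (1 + y ^+ 2)^-1.
  by rewrite -derive1_atan derive1E; apply/derivableP; exact: derivable_atan.
have Fd (a : R) : is_derive a (1 : R) F (poisson e (a - t)).
  have d1 := is_deriveZ pi^-1 (@is_derive1_comp _ atan
    (fun a => (2 * pi / e) * (a + - t)) a _ _ (ad _) (is_deriveZ (2 * pi / e) (sd a))).
  apply: (is_derive_eq d1); rewrite /GRing.scale /= /poisson.
  move: (pi : R) p0 => p p0; field.
  by apply/and3P; split; rewrite gt_eqF// ltr_wpDr ?exprn_gt0// sqr_ge0.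
have ab : t - d <= t + d by lra.
rewrite (Rintegral_FTC ab (@continuous_poisson e t e0) Fd).
rewrite /F (_ : t - d + - t = - d); last by ring.
rewrite (_ : t + d + - t = d); last by ring.
rewrite mulrN atanN mulrN opprK [2 * pi * d / e](_ : _ = 2 * pi / e * d); last by ring.
by ring.
Qed.

(** Three errors of eta / 3: the oscillation of h on a window of radius d' around t, the kernel
    outside the window weighted by |h|, and |h t| times the mass missing inside. The far part uses a
    pointwise bound on the kernel, so h may be unbounded. *)
Lemma poisson_approx h t (eta : R) : continuous h ->
  mu.-integrable setT (fun a => (h a)%:E) -> 0 < eta ->
  exists2 e0 : R, 0 < e0 & forall e, 0 < e -> e < e0 ->
    `| \int[mu]_a (h a * poisson e (a - t)) - h t | <= eta.
Proof.
move=> hc hi eta0.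
have p0 : 0 < pi :> R by exact: pi_gt0.
have pi_cancel (y : R) : 2 / pi * y * (pi / 2) = y.
  by move: (pi : R) p0 => p p0; field; rewrite gt_eqF.
have pi_inv : 2 / pi * (pi / 2) = 1 :> R.
  by rewrite -[X in _ = X]pi_cancel mulr1.
have e3 : 0 < eta / 3 by rewrite divr_gt0.
have /cvgrPdist_le/(_ _ e3)[d /= d0 hd] := hc t.
pose d' := d / 2; have d'0 : 0 < d' by rewrite divr_gt0.
have {}hd a : t - d' <= a <= t + d' -> `|h a - h t| <= eta / 3.
  move=> /andP[a1 a2]; rewrite distrC; apply: hd => /=.
  have : `|t - a| <= d' by rewrite ler_norml; lra.
  by rewrite /d'; lra.
clearbody d'.
pose H := \int[mu]_a `|h a|.
have H0 : 0 <= H by apply: Rintegral_ge0.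
(* Outside the window the kernel is at most 2 e / K. Below, [rho] is the mass that may be missing,
   scaled so that |h t| * rho <= eta / 3; the + 1 covers h t = 0. *)
pose K := (2 * pi * d') ^+ 2.
have K0 : 0 < K by rewrite exprn_gt0// !mulr_gt0.
pose rho := eta / (3 * (`|h t| + 1)).
have ht1 : 0 < `|h t| + 1 by rewrite ltr_wpDl.
have rho0 : 0 < rho by rewrite divr_gt0// mulr_gt0.
have [M M0 HM] : exists2 M : R, 0 < M & forall y, M < y -> 1 - rho <= 2 / pi * atan y.
  have rp : 0 < rho * (pi / 2) by rewrite mulr_gt0// divr_gt0.
  have /cvgrPdist_le/(_ _ rp)[M [_ HM]] := @cvgy_atan R.
  exists (Num.max M 1) => [|y]; first by rewrite lt_max ltr01 orbT.
  rewrite gt_max => /andP[/HM /= + _]; rewrite ler_norml => /andP[_ H1].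
  rewrite -(ler_pM2r (_ : 0 < pi / 2)) ?divr_gt0//.
  have -> : 2 / pi * atan y * (pi / 2) = atan y by exact: pi_cancel.
  by rewrite mulrBl mul1r; lra.
(* The first bound pushes 2 pi d' / e beyond M, so the window carries mass at least 1 - rho; the
   second makes the far part 2 e H / K at most eta / 3. *)
pose e0 := Num.min (2 * pi * d' / M) (eta * K / (6 * (H + 1))).
have H1 : 0 < H + 1 by rewrite ltr_wpDl.
exists e0.
  by rewrite lt_min !divr_gt0// !mulr_gt0.
move=> e ep; rewrite lt_min => /andP[eM eK].
pose P a := poisson e (a - t).
pose D : set R := [set` `[t - d', t + d']].
have Pc : continuous P := @continuous_poisson e t ep.
have Pm : measurable_fun setT P by exact: continuous_measurable_fun.
have P0 a : 0 <= P a by exact: poisson_ge0.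
pose q := P \_ D.
have Di : mu.-integrable D (fun a => (P a)%:E) by exact: continuous_integrable.
have qi : mu.-integrable setT (fun a => (q a)%:E).
  by have := (@integrable_mkcond _ _ _ mu _ (EFin \o P) (measurable_itv _)).1 Di;
    rewrite restrict_EFin.
have qE : \int[mu]_a q a = 2 / pi * atan (2 * pi * d' / e).
  by rewrite -Rintegral_mkcond Rintegral_poisson// ltW.
have q1 : \int[mu]_a q a <= 1.
  rewrite qE; have := atan_ltpi2 (2 * pi * d' / e) => /ltW.
  rewrite -(ler_pM2l (_ : 0 < 2 / pi)) ?divr_gt0// => /le_trans; apply.
  by rewrite pi_inv.
have q2 : 1 - rho <= \int[mu]_a q a.
  by rewrite qE; apply: HM; rewrite ltr_pdivlMr// mulrC -ltr_pdivlMr.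
have hPi : mu.-integrable setT (fun a => (h a * P a)%:E).
  apply: (@le_integrable _ _ _ mu setT _ _ (fun a => (2 / e * h a)%:E)) => //.
  - apply/measurable_EFinP; apply: measurable_funM => //; exact: continuous_measurable_fun.
  - move=> a _ /=; rewrite lee_fin normrM [leRHS]normrM mulrC; apply: ler_wpM2r => //.
    rewrite ger0_norm// [leRHS]ger0_norm; first exact: poisson_le.
    by rewrite divr_ge0// ltW.
  - exact: integrable_onZl.
have -> : \int[mu]_a (h a * poisson e (a - t)) - h t =
   \int[mu]_a (h a * P a - h t * q a) + h t * (\int[mu]_a q a - 1).
  rewrite RintegralB//; last exact: integrable_onZl.
  by rewrite RintegralZl// /P; ring.
have B1 : `|\int[mu]_a (h a * P a - h t * q a)| <= eta / 3 + eta / 3.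
  apply: (@le_trans _ _ (\int[mu]_a (eta / 3 * q a + (2 * e / K) * `|h a|))).
    apply: le_trans (le_normr_Rintegral _ _) _ => //.
      by apply: integrable_onB => //; exact: integrable_onZl.
    apply: le_Rintegral => //.
    - apply: integrable_norm => //; apply: integrable_onB => //; exact: integrable_onZl.
    - apply: integrable_onD => //; apply: integrable_onZl => //; exact: integrable_norm.
    move=> a _; rewrite /q patchE; case: ifPn => aD.
      rewrite -mulrBl normrM (ger0_norm (P0 a)).
      apply: (@le_trans _ _ (eta / 3 * P a)).
        apply: ler_wpM2r => //; apply: hd.
        by move: aD; rewrite inE /D /= in_itv.
      by rewrite lerDl mulr_ge0// divr_ge0 ?mulr_ge0// ltW.
    rewrite /= !mulr0 subr0 add0r normrM mulrC; apply: ler_wpM2r => //.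
    rewrite ger0_norm// /P /poisson.
    apply: ler_wpM2l; first by rewrite mulr_ge0// ltW.
    rewrite lef_pV2 ?posrE ?poisson_den_gt0// /K !exprMn.
    have da : d' ^+ 2 <= (a - t) ^+ 2.
      rewrite -(real_normK (num_real (a - t))) ler_pXn2r// ?nnegrE ?ltW//.
      move/negP: aD; rewrite inE /D /= in_itv /= => aD.
      rewrite ltNge ler_norml; apply/negP => /andP[? ?]; apply: aD.
      by apply/andP; split; lra.
    apply: (@le_trans _ _ (2 ^+ 2 * pi ^+ 2 * (a - t) ^+ 2)).
      by apply: ler_wpM2l da; rewrite mulr_ge0// sqr_ge0.
    by rewrite lerDr sqr_ge0.
  rewrite RintegralD//; last 2 first.
  - exact: integrable_onZl.
  - by apply: integrable_onZl => //; exact: integrable_norm.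
  rewrite !RintegralZl//; last exact: integrable_norm.
  apply: lerD; first by rewrite ler_piMr// ltW.
  rewrite -/H mulrAC ler_pdivrMr//.
  move: eK; rewrite ltr_pdivlMr ?mulr_gt0// => eK.
  by nra.
have B2 : `|h t * (\int[mu]_a q a - 1)| <= eta / 3.
  rewrite normrM; apply: (@le_trans _ _ (`|h t| * rho)).
    by apply: ler_wpM2l => //; rewrite ler_norml; lra.
  rewrite /rho mulrCA; apply: ler_wpM2l; first exact: ltW.
  rewrite invfM mulrCA ler_piMr ?invr_ge0// ler_pdivrMr// mul1r; lra.
apply: (le_trans (ler_normD _ _)); lra.
Qed.

End poisson_kernel.

(** * Recovering a real function from its cosine transform *)

Section real_inversion.
Variable R : realType.
Local Notation mu := (@lebesgue_measure R).
Local Notation mR := (measurableTypeR R).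
Implicit Types (h : R -> R) (t e w V L : R).

Lemma le_expR_eq0 (D c e L : R) : 0 < e ->
  (forall V, 0 <= V -> L <= V -> D <= expR (- e * V) * c) -> D <= 0.
Proof.
move=> e0 H; rewrite leNgt; apply/negP => D0.
(* At this V, D e V >= |c|, whereas exp(e V) >= 1 + e V would give D (1 + e V) <= |c|. *)
pose V := Num.max (Num.max 0 L) (`|c| / (D * e)).
have V0 : 0 <= V by rewrite /V !le_max lexx.
have LV : L <= V by rewrite /V !le_max lexx orbT.
have cV : `|c| <= V * (D * e).
  by rewrite -ler_pdivrMr ?mulr_gt0// /V le_max lexx orbT.
have := H V V0 LV; rewrite mulNr expRN mulrC ler_pdivlMr ?expR_gt0//.
have := expR_ge1Dx (e * V) => E1 E2.
have : D * (1 + e * V) <= `|c|.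
  by apply: le_trans (ler_norm c); apply: le_trans E2; rewrite ler_pM2l.
by move: cV; nra.
Qed.

(* C vanishes beyond L, so the integral over [0, L] may be extended to [0, V] for
   every V >= L; letting V grow turns the truncated kernel into the Poisson kernel. *)
Lemma damped_inversion h t L e : continuous h ->
  mu.-integrable setT (fun a => (h a)%:E) -> 0 <= L -> 0 < e ->
  let C := fun v => \int[mu]_a (h a * cos (2 * pi * (a - t) * v)) in
  continuous C -> (forall v, L <= v -> C v = 0) ->
  \int[mu]_(v in `[0, L]) (expR (- e * v) * C v) =
  \int[mu]_a (h a * (poisson e (a - t) / 2)).
Proof.
move=> hc hi L0 e0 C Cc C0.
have hm : measurable_fun setT h by exact: continuous_measurable_fun.
(* The absolute value keeps k bounded by 1 on the whole plane, as Fubini's theorem is applied with a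
   globally bounded kernel; the integrals see only v >= 0. *)
pose k (p : mR * mR) : R := expR (- e * `|p.2|) * cos (2 * pi * (p.1 - t) * p.2).
have km : measurable_fun setT k.
  apply: measurable_funM.
    apply: (measurableT_comp (continuous_measurable_fun (@continuous_expR_scale _ (- e)))) => //.
    by apply: measurableT_comp => //.
  apply: (measurableT_comp (continuous_measurable_fun (@continuous_cos R))) => //.
  apply: measurable_funM => //; apply: measurable_funM => //.
  by apply: measurable_funB.
have kM p : `|k p| <= 1.
  rewrite /k normrM ger0_norm ?expR_ge0//.
  rewrite -[leRHS]mulr1; apply: ler_pM => //; rewrite ?expR_ge0//.
    by rewrite -expR0 ler_expR mulNr oppr_le0 mulr_ge0// ltW.
  by rewrite ler_norml cos_geN1 cos_le1.
have hci v : mu.-integrable setT (fun a => (h a * cos (2 * pi * (a - t) * v))%:E).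
  apply: (@le_integrable _ _ _ mu setT _ _ (fun a => (h a)%:E)) => //.
  - apply/measurable_EFinP; apply: measurable_funM => //.
    apply: (measurableT_comp (continuous_measurable_fun (@continuous_cos R))) => //.
    apply: measurable_funM => //; apply: measurable_funM => //.
    exact: measurable_funB.
  - move=> a _ /=; rewrite lee_fin normrM ler_piMr// ler_norml.
    by rewrite cos_geN1 cos_le1.
have AV V : 0 <= V -> \int[mu]_(v in `[0, V]) (expR (- e * v) * C v) =
    \int[mu]_a (h a * \int[mu]_(v in `[0, V]) (expR (- e * v) * cos (2 * pi * (a - t) * v))).
  move=> V0; transitivity (\int[mu]_(v in `[0, V]) (\int[mu]_a (h a * k (a, v)))).
    apply: eq_Rintegral => v; rewrite inE /= in_itv /= => /andP[v0 _].
    rewrite /C -RintegralZl//; last exact: hci.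
    apply: eq_Rintegral => a _.
    by rewrite /k /= ger0_norm// mulrCA.
  rewrite (Rintegral_fubini_bounded V0 hi km kM).
  apply: eq_Rintegral => a _; congr (_ * _); apply: eq_Rintegral => v.
  by rewrite inE /= in_itv /= => /andP[v0 _]; rewrite /k /= ger0_norm.
pose J V a := \int[mu]_(v in `[0, V]) (expR (- e * v) * cos (2 * pi * (a - t) * v)).
have AL V : L <= V -> \int[mu]_(v in `[0, L]) (expR (- e * v) * C v) =
    \int[mu]_(v in `[0, V]) (expR (- e * v) * C v).
  move=> LV; rewrite [RHS](Rintegral_chasles L0 LV); last first.
    apply: continuous_integrable => v.
    exact: (continuousM (@continuous_expR_scale _ (- e) v) (Cc v)).
  rewrite [X in _ = _ + X](@eq_Rintegral _ _ _ _ _ (fun=> 0)).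
    by rewrite [X in _ = _ + X]/Rintegral integral0 addr0.
  move=> v; rewrite inE /= in_itv /= => /andP[Lv _].
  by rewrite C0// mulr0.
have Pi : mu.-integrable setT (fun a => (h a * (poisson e (a - t) / 2))%:E).
  apply: (@le_integrable _ _ _ mu setT _ _ (fun a => (e^-1 * h a)%:E)) => //.
  - apply/measurable_EFinP; apply: measurable_funM => //.
    apply: measurable_funM => //.
    by apply: continuous_measurable_fun; exact: (@continuous_poisson _ e t).
  - move=> a _ /=; rewrite lee_fin normrM [leRHS]normrM mulrC; apply: ler_wpM2r => //.
    rewrite ger0_norm; last by rewrite divr_ge0// poisson_ge0.
    rewrite ger0_norm ?invr_ge0 ?(ltW e0)//.
    by rewrite ler_pdivrMr// mulrC poisson_le.
  - exact: integrable_onZl.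
have Ji V : 0 <= V -> mu.-integrable setT (fun a => (h a * J V a)%:E).
  move=> V0.
  apply: (@le_integrable _ _ _ mu setT _ _ (fun a => (V * h a)%:E)) => //.
  - apply/measurable_EFinP; apply: measurable_funM => //.
    have D0 a : e ^+ 2 + (2 * pi * (a - t)) ^+ 2 != 0.
      exact: lt0r_neq0 (poisson_den_gt0 _ e0).
    (* Measurability in a is read off the closed form of the damped integral. *)
    rewrite /J; under eq_fun do rewrite Rintegral_damped_cos//.
    have mw : measurable_fun setT (fun a : mR => 2 * pi * (a - t)).
      by apply: measurable_funM => //; apply: measurable_funB.
    have mwV : measurable_fun setT (fun a : mR => 2 * pi * (a - t) * V).
      by apply: measurable_funM.
    have ms := measurableT_comp (continuous_measurable_fun (@continuous_sin R)) mwV.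
    have mc := measurableT_comp (continuous_measurable_fun (@continuous_cos R)) mwV.
    apply: measurable_funM.
      apply: measurable_funD => //; apply: measurable_funM => //.
      by apply: measurable_funB; apply: measurable_funM.
    have -> : (fun a => (e ^+ 2 + (2 * pi * (a - t)) ^+ 2)^-1) =
      (fun a => poisson e (a - t) * (2 * e)^-1).
      apply/funext => a; rewrite /poisson; move: (_ + _) (D0 a) => D Dn; field.
      by rewrite Dn gt_eqF.
    apply: measurable_funM => //.
    by apply: continuous_measurable_fun; exact: (@continuous_poisson _ e t).
  - move=> a _ /=; rewrite lee_fin normrM [leRHS]normrM mulrC; apply: ler_wpM2r => //.
    rewrite (ger0_norm V0).
    have ci : mu.-integrable `[0, V] (EFin \o (fun v => expR (- e * v) * cos (2 * pi * (a - t) * v))).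
      apply: continuous_integrable => v.
      exact: (continuousM (@continuous_expR_scale _ (- e) v) (@continuous_cos_scale _ _ v)).
    apply: le_trans (le_normr_Rintegral _ ci) _ => //.
    apply: (@le_trans _ _ (\int[mu]_(v in `[0, V]) 1)).
      apply: le_Rintegral => //.
      + exact: integrable_norm.
      + by apply: continuous_integrable => v; exact: cvg_cst.
      move=> v /=; rewrite in_itv /= => /andP[v0 _].
      by have := kM (a, v); rewrite /k /= (ger0_norm v0).
    rewrite Rintegral_cst// mul1r.
    rewrite (_ : fine _ = V)//.
    transitivity (fine (lebesgue_measure (`[0, V] : set R))); first by [].
    by rewrite lebesgue_measure_itv/= lte_fin; case: ltP => /= V1; lra.
  - exact: integrable_onZl.
apply/eqP; rewrite -subr_eq0 -normr_le0; apply: (@le_expR_eq0 _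
  ((2 / e) * \int[mu]_a `|h a|) _ L e0) => V V0 LV.
rewrite (AL V LV) AV// -/(J V) -RintegralB//; last exact: Ji.
apply: le_trans (le_normr_Rintegral _ _) _ => //.
  by apply: integrable_onB => //; exact: Ji.
rewrite mulrA -RintegralZl//; last exact: integrable_norm.
apply: le_Rintegral => //.
- by apply: integrable_norm => //; apply: integrable_onB => //; exact: Ji.
- by apply: integrable_onZl => //; exact: integrable_norm.
move=> a _; rewrite -mulrBr normrM mulrC; apply: ler_wpM2r => //.
have -> : poisson e (a - t) / 2 = e / (e ^+ 2 + (2 * pi * (a - t)) ^+ 2).
  by rewrite /poisson mulrAC; congr (_ / _); rewrite mulrAC mulfV// mul1r.
exact: poisson_kernel_tail.
Qed.

(** The damping is removed: on [0, L] the factor exp(- e v) differs from 1 by at most e L, while the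
    Poisson average of h is close to h t. Bounding the difference by every eta > 0 replaces a limit
    in e. *)
Lemma real_inversion h t L : continuous h ->
  mu.-integrable setT (fun a => (h a)%:E) -> 0 <= L ->
  let C := fun v => \int[mu]_a (h a * cos (2 * pi * (a - t) * v)) in
  continuous C -> (forall v, L <= v -> C v = 0) ->
  \int[mu]_(v in `[0, L]) (2 * C v) = h t.
Proof.
move=> hc hi L0 C Cc C0.
have Ci : mu.-integrable `[0, L] (EFin \o C) by exact: continuous_integrable.
rewrite RintegralZl//.
pose K := \int[mu]_(v in `[0, L]) `|C v|.
have K0 : 0 <= K by apply: Rintegral_ge0.
apply/eqP; rewrite -subr_eq0 -normr_le0; apply/ler_addgt0Pl => eta eta0.
rewrite addr0.
have eta2 : 0 < eta / 2 by rewrite divr_gt0.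
have [e0 e00 He] := @poisson_approx _ _ t _ hc hi eta2.
(* Halving e0 makes e < e0 strict; the other bound keeps the damping error 2 e L K below eta / 2. *)
pose e := Num.min (e0 / 2) (eta / 2 / (2 * L * K + 1)).
have D0 : 0 < 2 * L * K + 1 by rewrite ltr_wpDl// !mulr_ge0.
have ep : 0 < e by rewrite /e lt_min !divr_gt0.
have ee0 : e < e0 by rewrite /e gt_min; apply/orP; left; lra.
have eK : e * (2 * L * K) <= eta / 2.
  have : e <= eta / 2 / (2 * L * K + 1) by rewrite /e ge_min lexx orbT.
  by rewrite ler_pdivlMr//; nra.
have := He e ep ee0.
have -> : \int[mu]_a (h a * poisson e (a - t)) =
   2 * \int[mu]_(v in `[0, L]) (expR (- e * v) * C v).
  rewrite (damped_inversion hc hi L0 ep Cc C0) -RintegralZl//; last first.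
    apply: (@le_integrable _ _ _ mu setT _ _ (fun a => (e^-1 * h a)%:E)) => //.
    - apply/measurable_EFinP; apply: measurable_funM => //.
        exact: continuous_measurable_fun.
      apply: measurable_funM => //.
      by apply: continuous_measurable_fun; exact: (@continuous_poisson _ e t).
    - move=> a _ /=; rewrite lee_fin normrM [leRHS]normrM mulrC; apply: ler_wpM2r => //.
      rewrite ger0_norm; last by rewrite divr_ge0// poisson_ge0.
      rewrite ger0_norm ?invr_ge0 ?(ltW ep)//.
      by rewrite ler_pdivrMr// mulrC poisson_le.
    - exact: integrable_onZl.
  by apply: eq_Rintegral => a _; field.
move=> H1.
have eCi : mu.-integrable `[0, L] (EFin \o (fun v => expR (- e * v) * C v)).
  apply: continuous_integrable => v.
  exact: (continuousM (@continuous_expR_scale _ (- e) v) (Cc v)).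
have : `|\int[mu]_(v in `[0, L]) C v - \int[mu]_(v in `[0, L]) (expR (- e * v) * C v)| <= e * L * K.
  rewrite -RintegralB// -RintegralZl//; last exact: integrable_norm.
  apply: le_trans (le_normr_Rintegral _ _) _ => //; first exact: integrable_onB.
  apply: le_Rintegral => //.
  - by apply: integrable_norm => //; exact: integrable_onB.
  - by apply: integrable_onZl => //; exact: integrable_norm.
  move=> v /=; rewrite in_itv /= => /andP[v0 vL].
  rewrite -{1}[C v]mul1r -mulrBl normrM; apply: ler_wpM2r => //.
  have E1 := expR_ge1Dx (- e * v).
  have E2 : expR (- e * v) <= 1 by rewrite -expR0 ler_expR mulNr oppr_le0 mulr_ge0// ltW.
  have E3 : e * v <= e * L by rewrite ler_pM2l.
  by rewrite ger0_norm; nra.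
move: H1; move: (\int[mu]_(v in _) C v) (\int[mu]_(v in _) _) => I1 I2.
have {}eK : 2 * (e * L * K) <= eta / 2 by apply: le_trans eK; lra.
clearbody K e => H1 H2; apply: (@le_trans _ _ (eta / 2 + eta / 2)); last by lra.
have -> : 2 * I1 - h t = 2 * (I1 - I2) + (2 * I2 - h t) by ring.
apply: (le_trans (ler_normD _ _)); apply: lerD => //.
by rewrite normrM ger0_norm//; apply: le_trans eK; rewrite ler_pM2l.
Qed.
End real_inversion.

(** * Complex inversion for a compactly supported transform *)

Section inversion.
Variable R : realType.
Implicit Types (h phi psi : R -> R[i]) (z : R[i]) (a b c v f t L : R).
Local Notation Re := (@complex.Re R).
Local Notation Im := (@complex.Im R).
Local Notation mu := (@lebesgue_measure R).

Lemma cabsZ a z : cabs (a%:C * z) = `|a| * cabs z.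
Proof. by rewrite /cabs cReM cImM /= !mul0r subr0 addr0 !normrM mulrDr. Qed.

Lemma expj_conj_sum a : expj a + expj (- a) = (2 * cos a)%:C.
Proof. by apply: ceqP; rewrite (cReD, cImD) /= ?cosN ?sinN; ring. Qed.

(** The sine parts cancel between v and - v. The real and imaginary parts of h then no longer mix,
    and the real inversion applies to each. *)
Lemma osc_symm h t v : cintegrable h ->
  osc (2 * pi) h v * expj (- (2 * pi * t * v)) +
  osc (2 * pi) h (- v) * expj (2 * pi * t * v) =
  (2 : R)%:C * ((\int[mu]_a (Re (h a) * cos (2 * pi * (a - t) * v))) +i*
       (\int[mu]_a (Im (h a) * cos (2 * pi * (a - t) * v)))).
Proof.
move=> hi; rewrite /osc !cintegral_onT mulrC [X in _ + X]mulrC.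
have i1 := cintegrable_expj (2 * pi * v) hi.
have i2 := cintegrable_expj (2 * pi * - v) hi.
rewrite -!cintegral_onZ//.
rewrite -cintegral_onD//; [|exact: cintegrable_onZ..].
have hci : cintegrable (fun a => (cos (2 * pi * (a - t) * v))%:C * h a).
  apply: (@cintegrable_onM _ setT _ _ 1) => //.
    apply: ccontinuous_cmeasurable => //; apply: ccontinuous_C => a.
    have cc : {for a, continuous (fun a : R => 2 * pi * (a - t) * v)}.
      apply: cvgM; last exact: cvg_cst.
      by apply: cvgM; [exact: cvg_cst|apply: cvgB; [exact: cvg_id|exact: cvg_cst]].
    exact: (continuous_comp cc (@continuous_cos R _)).
  by move=> a _; rewrite cabs_real ler_norml cos_geN1 cos_le1.
transitivity (cintegral_on setT (fun a => (2 : R)%:C * ((cos (2 * pi * (a - t) * v))%:C * h a))).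
  apply: eq_cintegral_on => a _; rewrite mulrCA [X in _ + X]mulrCA -mulrDr.
  rewrite -!expjD [LHS]mulrC [RHS]mulrA; congr (_ * _).
  have -> : 2 * pi * t * v + 2 * pi * - v * a = - (2 * pi * (a - t) * v) by ring.
  have -> : - (2 * pi * t * v) + 2 * pi * v * a = 2 * pi * (a - t) * v by ring.
  by rewrite expj_conj_sum real_complexM.
rewrite cintegral_onZ//; congr (_ * _).
by apply: ceqP; rewrite /=; apply: eq_Rintegral => a _; case: (h a) => p q /=; ring.
Qed.

(** The first moment makes the transform continuous, and vanishing beyond L turns the inversion
    integral into one over a bounded interval. *)
Lemma fourier_inversion h L t : ccontinuous h -> cintegrable h ->
  cintegrable (fun a => a%:C * h a) -> 0 <= L ->
  (forall v, L <= `|v| -> osc (2 * pi) h v = 0) ->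
  fourier_fun (osc (2 * pi) h) t = h t.
Proof.
move=> hc hi thi L0 G0.
have Gc := osc_ccontinuous (2 * pi) hi thi.
pose g v := osc (2 * pi) h v * expj (- (2 * pi * t * v)).
have gc : ccontinuous g.
  apply: ccontinuousM => //; under eq_fun do rewrite -mulNr.
  exact: ccontinuous_expj_scale.
rewrite /fourier_fun (@cintegral_compact _ _ L); last first.
  by move=> v Lv; rewrite G0 ?mul0r// ltW.
rewrite (cintegral_reflect L0 gc).
pose gs v := g v + g (- v).
have gsE v : gs v = (2 : R)%:C * ((\int[mu]_a (Re (h a) * cos (2 * pi * (a - t) * v))) +i*
       (\int[mu]_a (Im (h a) * cos (2 * pi * (a - t) * v)))).
  by rewrite -osc_symm// /gs /g mulrN opprK.
have gsc : ccontinuous gs.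
  by apply: ccontinuousD => //; apply: ccontinuous_comp => //; exact: opp_continuous.
have gs0 v : L <= v -> gs v = 0.
  move=> Lv; have v0 : 0 <= v by exact: le_trans Lv.
  by rewrite /gs /g !G0 ?normrN ?ger0_norm// !mul0r addr0.
pose C1 v := \int[mu]_a (Re (h a) * cos (2 * pi * (a - t) * v)).
pose C2 v := \int[mu]_a (Im (h a) * cos (2 * pi * (a - t) * v)).
have C1E v : C1 v = 2^-1 * Re (gs v).
  by rewrite gsE cReM /= mul0r subr0 mulrA mulVf ?mul1r.
have C2E v : C2 v = 2^-1 * Im (gs v).
  by rewrite gsE cImM /= mul0r addr0 mulrA mulVf ?mul1r.
have [g1 g2] := gsc; have [h1 h2] := hc; have [i1 i2] := hi.
have C1c : continuous C1.
  have -> : C1 = (fun v => 2^-1 * Re (gs v)) by apply/funext.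
  by move=> v; apply: cvgM; [exact: cvg_cst|exact: g1].
have C2c : continuous C2.
  have -> : C2 = (fun v => 2^-1 * Im (gs v)) by apply/funext.
  by move=> v; apply: cvgM; [exact: cvg_cst|exact: g2].
apply: ceqP => /=.
  rewrite -(real_inversion (t := t) h1 i1 L0 C1c) => [|v Lv].
    apply: eq_Rintegral => v _; rewrite -/(gs v) -/(C1 v) C1E.
    by rewrite mulrA mulfV ?mul1r.
  by rewrite -/(C1 v) C1E gs0//= mulr0.
rewrite -(real_inversion (t := t) h2 i2 L0 C2c) => [|v Lv].
  apply: eq_Rintegral => v _; rewrite -/(gs v) -/(C2 v) C2E.
  by rewrite mulrA mulfV ?mul1r.
by rewrite -/(C2 v) C2E gs0//= mulr0.
Qed.

End inversion.

(** * Band-limited signals *)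

Section band_limited_signal.
Variables (R : realType) (fmax : R) (x : R -> R[i]) (X : distr R).
Hypothesis x_cont : ccontinuous x.
Hypothesis x_temp : tempered_fun x.
Hypothesis X_fourier : X =d fourier (distr_of_fun x).
Hypothesis x_band : band_limited fmax X.
Implicit Types (phi psi : R -> R[i]) (z : R[i]) (a b c v f t L : R).
Local Notation mu := (@lebesgue_measure R).

Definition wsignal phi t := x t * fourier_fun phi t.

Lemma wsignal_ccontinuous phi : test_function phi -> ccontinuous (wsignal phi).
Proof.
move=> pt; apply: ccontinuousM => //; apply: fourier_fun_ccontinuous.
  exact: test_function_ccontinuous.
exact: test_function_cs.
Qed.

(** The rapid decay of F phi pays for the weight (1 + t^2)^m that separates x from an integrable
    function. *)
Lemma wsignal_integrable phi : test_function phi ->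
  cintegrable (wsignal phi) /\ cintegrable (fun a => a%:C * wsignal phi a).
Proof.
move=> pt; have [m xi] := x_temp.
have Fc : ccontinuous (fourier_fun phi).
  apply: fourier_fun_ccontinuous; first exact: test_function_ccontinuous.
  exact: test_function_cs.
have D0 t : 0 < 1 + t ^+ 2 by rewrite ltr_wpDr// sqr_ge0.
have pc : continuous (fun t : R => (1 + t ^+ 2) ^+ m).
  move=> t; apply: (@continuous_comp _ _ _ (fun t : R => 1 + t ^+ 2) (fun y => y ^+ m)).
    by apply: cvgD; [exact: cvg_cst|exact: exprn_continuous].
  exact: exprn_continuous.
pose y t := ((1 + t ^+ 2) ^- m)%:C * x t.
pose u t := ((1 + t ^+ 2) ^+ m)%:C * fourier_fun phi t.
have uc : ccontinuous u by apply: ccontinuousM => //; exact: ccontinuous_C.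
have xE t : wsignal phi t = u t * y t.
  have xy : x t = ((1 + t ^+ 2) ^+ m)%:C * y t.
    rewrite /y mulrA -real_complexM mulfV ?mul1r// expf_neq0// gt_eqF//.
  by rewrite /wsignal xy /u; ring.
split.
  have [C HC] := fourier_rapid m pt.
  have -> : wsignal phi = (fun t => u t * y t) by exact/funext.
  apply: (@cintegrable_onM _ setT y u C) => //.
    exact: ccontinuous_cmeasurable.
  by move=> t _; exact: HC.
(* One more factor 1 + t^2 absorbs |t|, as |t| <= 1 + t^2. *)
have [C HC] := fourier_rapid m.+1 pt.
have -> : (fun a => a%:C * wsignal phi a) = (fun t => (t%:C * u t) * y t).
  by apply/funext => t; rewrite xE mulrA.
apply: (@cintegrable_onM _ setT y (fun t => t%:C * u t) C) => //.
  apply: ccontinuous_cmeasurable => //; apply: ccontinuousM => //.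
  exact: ccontinuous_id.
move=> t _; apply: le_trans (HC t).
rewrite /u !cabsZ [_ ^+ m.+1]exprS normrM -mulrA; apply: ler_wpM2r.
  by rewrite mulr_ge0// cabs_ge0.
rewrite (ger0_norm (ltW (D0 t))) -(real_normK (num_real t)).
by have := sqr_ge0 (`|t| - 1); nra.
Qed.

Definition spectrum_shift phi v : R[i] := X (fun u => phi (u + v)).

Lemma spectrum_test phi : test_function phi ->
  X phi = cintegral (wsignal phi).
Proof. exact: X_fourier. Qed.

(** A [distr] carries no linearity; X is linear on test functions because it acts there by
    integration against x * F phi. *)
Lemma spectrumD phi psi : test_function phi -> test_function psi ->
  X (fun u => phi u + psi u) = X phi + X psi.
Proof.
move=> pt qt; rewrite !spectrum_test//; last exact: test_functionD.
rewrite !cintegral_onT -cintegral_onD//.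
- apply: eq_cintegral_on => t _; rewrite /wsignal fourierD ?mulrDr//;
    exact: test_function_cintegrable.
- by have [] := wsignal_integrable pt.
- by have [] := wsignal_integrable qt.
Qed.

Lemma spectrumZ z phi : test_function phi -> X (fun u => z * phi u) = z * X phi.
Proof.
move=> pt; rewrite !spectrum_test//; last exact: test_functionZ.
rewrite !cintegral_onT -cintegral_onZ//; last by have [] := wsignal_integrable pt.
apply: eq_cintegral_on => t _; rewrite /wsignal fourierZ; first exact: mulrCA.
exact: test_function_cintegrable.
Qed.

Lemma spectrum_shiftE phi v : test_function phi ->
  spectrum_shift phi v = osc (2 * pi) (wsignal phi) v.
Proof.
move=> pt; rewrite /spectrum_shift spectrum_test; last exact: test_function_shift.
congr cintegral; apply/funext => t; rewrite /wsignal fourier_shift.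
- by rewrite mulrA mulrAC.
- exact: test_function_ccontinuous.
- exact: test_function_cs.
Qed.

Lemma spectrum_shift_support phi : test_function phi ->
  exists2 L, 0 <= L & forall v, L <= `|v| -> spectrum_shift phi v = 0.
Proof.
move=> pt; have [_ [B pB]] := (test_functionP phi).1 pt.
(* The extra 1 makes room for the closure in [band_limited]: the shifted function lives in the
   closed set |f| >= |fmax| + 1, strictly outside the band. *)
exists (`|fmax| + `|B| + 1) => [|v Lv]; first by rewrite !addr_ge0.
apply: x_band; first exact: test_function_shift.
apply: (@subset_trans _ [set f | `|fmax| + 1 <= `|f|]); last first.
  by move=> f /=; have := ler_norm fmax; lra.
have : closed [set f : R | `|fmax| + 1 <= `|f|].
  apply: (@closed_comp _ _ (fun f : R => `|f|) [set f | `|fmax| + 1 <= f]).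
    by move=> f _; exact: norm_continuous.
  exact: closed_ge.
rewrite closure_id => ->; apply: closure_subset => f /= pf.
rewrite leNgt; apply/negP => fl; move/eqP: pf; apply; apply: pB.
have := ler_normB (f + v) f; rewrite addrAC subrr add0r => H.
have := ler_norm B; lra.
Qed.

Lemma spectrum_shift_ccontinuous phi : test_function phi ->
  ccontinuous (spectrum_shift phi).
Proof.
move=> pt; have -> : spectrum_shift phi = osc (2 * pi) (wsignal phi).
  by apply/funext => v; exact: spectrum_shiftE.
by have [i1 i2] := wsignal_integrable pt; exact: osc_ccontinuous.
Qed.

Lemma spectrum_shift_lipschitz phi : test_function phi ->
  exists C : R, forall v w,
    cabs (spectrum_shift phi v - spectrum_shift phi w) <= C * `|v - w|.
Proof.
move=> pt; have [i1 i2] := wsignal_integrable pt.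
have [C HC] := osc_lipschitz (2 * pi) i1 i2.
by exists C => v w; rewrite !spectrum_shiftE.
Qed.

Lemma spectrum_shift_cs phi : test_function phi ->
  compactly_supported (spectrum_shift phi).
Proof.
move=> pt; have [L _ HL] := spectrum_shift_support pt.
by exists L => v /ltW; exact: HL.
Qed.

Lemma fourier_spectrum_shift phi t : test_function phi ->
  fourier_fun (spectrum_shift phi) t = wsignal phi t.
Proof.
move=> pt; have [L L0 HL] := spectrum_shift_support pt.
have E : spectrum_shift phi = osc (2 * pi) (wsignal phi).
  by apply/funext => v; exact: spectrum_shiftE.
have [i1 i2] := wsignal_integrable pt.
rewrite E; apply: (@fourier_inversion _ _ L) => //.
  exact: wsignal_ccontinuous.
by move=> v; rewrite -E; exact: HL.
Qed.

(* x need not be polynomially bounded a priori; the decay of x * F phi at the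
   sampling points comes from inverting phi - phi'' / (2 pi)^2 instead of phi. *)
Lemma wsignal_decay phi : test_function phi ->
  exists C : R, forall t, (1 + t ^+ 2) * cabs (wsignal phi t) <= C.
Proof.
move=> pt; have bt := test_function_bessel pt.
have Gi : cintegrable (spectrum_shift (bessel_op phi)).
  by apply: cs_cintegrable; [exact: spectrum_shift_ccontinuous|exact: spectrum_shift_cs].
have [C HC] := osc_bound (- (2 * pi)) Gi.
exists C => t; have := HC t; rewrite -fourier_funE fourier_spectrum_shift//.
rewrite /wsignal fourier_bessel// mulrCA cabsZ ger0_norm//.
by rewrite addr_ge0// sqr_ge0.
Qed.

End band_limited_signal.

(** * Series over the integers *)

Section sumsZ.
Variable R : realType.
Implicit Types (u : nat -> R).
Local Notation Re := (@complex.Re R).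
Local Notation Im := (@complex.Im R).

(** Unlike [sumZ], this asserts that both one-sided series converge, and so it is compatible with
    sums and scalar multiples. *)
Definition sumsZ (a : int -> R) (l : R) : Prop := exists l1 l2,
  [/\ (fun n => \sum_(k < n) a (Posz k)) @ \oo --> l1,
      (fun n => \sum_(k < n) a (Negz k)) @ \oo --> l2 & l = l1 + l2].

Definition csumsZ (a : int -> R[i]) (l : R[i]) : Prop :=
  sumsZ (fun k => Re (a k)) (Re l) /\ sumsZ (fun k => Im (a k)) (Im l).

Lemma sumsZ_sumZ a l : sumsZ a l -> sumZ a = l.
Proof.
move=> [l1 [l2 [h1 h2 ->]]]; rewrite /sumZ !seriesEord.
by congr (_ + _); apply/cvg_lim.
Qed.

Lemma csumsZ_csumZ a l : csumsZ a l -> csumZ a = l.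
Proof. by move=> [/sumsZ_sumZ h1 /sumsZ_sumZ h2]; apply: ceqP. Qed.

Lemma sumsZD a b l m : sumsZ a l -> sumsZ b m -> sumsZ (fun k => a k + b k) (l + m).
Proof.
move=> [l1 [l2 [h1 h2 ->]]] [m1 [m2 [g1 g2 ->]]]; exists (l1 + m1), (l2 + m2).
split; last exact: addrACA.
  by under eq_fun do rewrite big_split; exact: cvgD.
by under eq_fun do rewrite big_split; exact: cvgD.
Qed.

Lemma sumsZZ c a l : sumsZ a l -> sumsZ (fun k => c * a k) (c * l).
Proof.
move=> [l1 [l2 [h1 h2 ->]]]; exists (c * l1), (c * l2).
split; last by rewrite mulrDr.
  by under eq_fun do rewrite -mulr_sumr; apply: cvgM => //; exact: cvg_cst.
by under eq_fun do rewrite -mulr_sumr; apply: cvgM => //; exact: cvg_cst.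
Qed.

Lemma csumsZD a b l m : csumsZ a l -> csumsZ b m -> csumsZ (fun k => a k + b k) (l + m).
Proof.
move=> [a1 a2] [b1 b2]; split; [rewrite cReD|rewrite cImD];
  under eq_fun do rewrite (cReD, cImD); exact: sumsZD.
Qed.

Lemma csumsZZ c a l : csumsZ a l -> csumsZ (fun k => c * a k) (c * l).
Proof.
move=> [a1 a2]; split; [rewrite cReM|rewrite cImM];
  under eq_fun do rewrite (cReM, cImM) -?mulNr; rewrite -?mulNr;
  by apply: sumsZD; exact: sumsZZ.
Qed.

Lemma csumsZ_sum N (a : 'I_N -> int -> R[i]) (l : 'I_N -> R[i]) :
  (forall n, csumsZ (a n) (l n)) ->
  csumsZ (fun k => \sum_(n < N) a n k) (\sum_(n < N) l n).
Proof.
elim: N a l => [|N IH] a l al.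
  rewrite big_ord0; under eq_fun do rewrite big_ord0.
  by split; exists 0, 0; split; rewrite ?addr0//;
    under eq_fun do rewrite big1//; exact: cvg_cst.
rewrite big_ord_recl; under eq_fun do rewrite big_ord_recl.
by apply: csumsZD => //; exact: IH.
Qed.

Lemma sumsZ_finite a (M : nat) :
  (forall k, (M <= k)%N -> a (Posz k) = 0) -> (forall k, (M <= k)%N -> a (Negz k) = 0) ->
  sumsZ a (\sum_(k < M) a (Posz k) + \sum_(k < M) a (Negz k)).
Proof.
have H (u : nat -> R) : (forall k, (M <= k)%N -> u k = 0) ->
    (fun n => \sum_(k < n) u k) @ \oo --> \sum_(k < M) u k.
  move=> u0; apply: cvg_near_cst.
  exists M => // n /= Mn.
  rewrite -!(big_mkord xpredT u) (big_cat_nat (n := M))//=.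
  rewrite [X in _ + X](_ : _ = 0) ?addr0// big_nat_cond big1// => k.
  by move=> /andP[/andP[Mk _] _]; exact: u0.
move=> h1 h2; exists (\sum_(k < M) a (Posz k)), (\sum_(k < M) a (Negz k)).
by split=> //; [exact: (H (fun k => a (Posz k)))|exact: (H (fun k => a (Negz k)))].
Qed.

Lemma csumsZ_finite (a : int -> R[i]) (M : nat) :
  (forall k, (M <= k)%N -> a (Posz k) = 0) -> (forall k, (M <= k)%N -> a (Negz k) = 0) ->
  csumsZ a (\sum_(k < M) a (Posz k) + \sum_(k < M) a (Negz k)).
Proof.
move=> h1 h2; split; rewrite (cReD, cImD) (cRe_sum, cIm_sum) (cRe_sum, cIm_sum).
  by apply: (@sumsZ_finite (fun k => Re (a k))) => k /= Mk; rewrite ?h1 ?h2.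
by apply: (@sumsZ_finite (fun k => Im (a k))) => k /= Mk; rewrite ?h1 ?h2.
Qed.

Lemma quadratic_decay_cvg u (d C : R) : 0 < d ->
  (forall k : nat, (1 + (k%:R * d) ^+ 2) * `|u k| <= C) ->
  cvgn (fun n => \sum_(k < n) u k).
Proof.
move=> d0 uC.
have C0 : 0 <= C.
  by apply: le_trans (uC 0%N); rewrite mulr_ge0// addr_ge0// sqr_ge0.
(* From (k + 1) (k + 2) <= 4 (1 + k^2) and 1 + k^2 <= (1 + d^-2) (1 + k^2 d^2); the majorant 1 / ((k
   + 1) (k + 2)) telescopes. *)
pose K := 4 * C * (1 + (d ^+ 2)^-1).
have d20 : 0 < d ^+ 2 by rewrite exprn_gt0.
have K0 : 0 <= K by rewrite !mulr_ge0// addr_ge0// invr_ge0 ltW.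
have uK (k : nat) : `|u k| <= K * ((k.+1%:R)^-1 - (k.+2%:R)^-1).
  have k0 : 0 <= k%:R :> R by [].
  have -> : k.+1%:R^-1 - k.+2%:R^-1 = ((k%:R + 1) * (k%:R + 2))^-1 :> R.
    rewrite -[k.+2]addn2 -[k.+1]addn1 !natrD; field.
    by apply/andP; split; rewrite gt_eqF// ltr_wpDl.
  rewrite ler_pdivlMr ?mulr_gt0 ?ltr_wpDl//.
  have := uC k; rewrite exprMn; set y := k%:R in k0 *; set w := `|u k| => H.
  have w0 : 0 <= w by exact: normr_ge0.
  apply: (@le_trans _ _ (4 * (1 + (d ^+ 2)^-1) * ((1 + y ^+ 2 * d ^+ 2) * w))).
    rewrite [leLHS]mulrC [leRHS]mulrA; apply: ler_wpM2r => //.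
    have -> : 4 * (1 + (d ^+ 2)^-1) * (1 + y ^+ 2 * d ^+ 2) =
      4 * (1 + y ^+ 2) + 4 * (y ^+ 2 * d ^+ 2 + (d ^+ 2)^-1).
      by field; rewrite gt_eqF.
    have : 0 <= y ^+ 2 * d ^+ 2 + (d ^+ 2)^-1.
      by rewrite addr_ge0 ?mulr_ge0 ?invr_ge0 ?sqr_ge0// ltW.
    by have := sqr_ge0 (y - 1); nra.
  have -> : K = 4 * (1 + (d ^+ 2)^-1) * C by rewrite /K; ring.
  by apply: ler_wpM2l => //; rewrite mulr_ge0// addr_ge0// invr_ge0 ltW.
have bound n : \sum_(k < n) `|u k| <= K * (1 - (n.+1%:R)^-1).
  elim: n => [|n IH]; first by rewrite big_ord0 invr1 subrr mulr0.
  rewrite big_ord_recr /=; apply: le_trans (lerD IH (uK n)) _.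
  by rewrite -mulrDr addrA subrK.
have -> : (fun n => \sum_(k < n) u k) = series u by rewrite seriesEord.
apply: normed_cvg.
apply: nondecreasing_is_cvgn.
  by apply: nondecreasing_series => k _ _; exact: normr_ge0.
exists K => _ [n _ <-]; rewrite /normed_series_of /series /= big_mkord.
apply: (le_trans (bound n)).
by rewrite ler_piMr// gerBl invr_ge0.
Qed.

Lemma cvg_mulnr (N : nat) : (0 < N)%N -> (fun K => K * N)%N @ \oo --> \oo.
Proof.
move=> N0; apply/cvgnyPge => A; exists A => // K /= AK.
exact: leq_trans AK (leq_pmulr _ N0).
Qed.

Lemma sum_blocks (V : nmodType) (u : nat -> V) (N K : nat) :
  \sum_(j < K * N) u j = \sum_(n < N) \sum_(k < K) u (k * N + n)%N.
Proof.
elim: K => [|K IH].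
  by rewrite mul0n big_ord0; under eq_bigr do rewrite big_ord0; rewrite big1.
rewrite [RHS](eq_bigr (fun n : 'I_N => \sum_(k < K) u (k * N + n)%N + u (K * N + n)%N));
  last by move=> n _; rewrite big_ord_recr.
rewrite big_split /= -IH -!(big_mkord xpredT) mulSn addnC.
rewrite (big_cat_nat (n := (K * N)%N)) ?leq_addr//=; congr (_ + _).
rewrite -{1}[(K * N)%N]add0n big_addn addKn big_mkord.
by apply: eq_bigr => i _; rewrite addnC.
Qed.

Lemma cvg_sum_ord N (F : 'I_N -> nat -> R) (l : 'I_N -> R) :
  (forall n, F n @ \oo --> l n) ->
  (fun K => \sum_(n < N) F n K) @ \oo --> \sum_(n < N) l n.
Proof.
elim: N F l => [|N IH] F l Fl.
  rewrite big_ord0; under eq_fun do rewrite big_ord0; exact: cvg_cst.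
rewrite big_ord_recl; under eq_fun do rewrite big_ord_recl.
by apply: cvgD; [exact: Fl|exact: IH].
Qed.

(** Decay makes the full series and every residue-class series converge. Partial sums of length K N
    split exactly into N partial sums of length K, so the limits agree along this subsequence. *)
Lemma nat_regroup u (N : nat) (d C : R) : (0 < N)%N -> 0 < d ->
  (forall k : nat, (1 + (k%:R * d) ^+ 2) * `|u k| <= C) ->
  exists (l : 'I_N -> R) (m : R),
  [/\ forall n : 'I_N, (fun K => \sum_(k < K) u (k * N + n)%N) @ \oo --> l n,
      (fun K => \sum_(k < K) u k) @ \oo --> m & m = \sum_(n < N) l n].
Proof.
move=> N0 d0 uC.
have ucvg := quadratic_decay_cvg d0 uC.
have bcvg (n : 'I_N) : cvgn (fun K => \sum_(k < K) u (k * N + n)%N).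
  apply: (@quadratic_decay_cvg (fun k => u (k * N + n)%N) d C d0) => k.
  apply: le_trans (uC (k * N + n)%N); apply: ler_wpM2r => //.
  rewrite lerD2l ler_pXn2r ?nnegrE ?mulr_ge0 ?(ltW d0)// ler_pM2r// ler_nat.
  exact: leq_trans (leq_pmulr _ N0) (leq_addr _ _).
exists (fun n => limn (fun K => \sum_(k < K) u (k * N + n)%N)).
exists (limn (fun K => \sum_(k < K) u k)).
split; [by []|by []|].
have h1 : (fun K => \sum_(j < K * N) u j) @ \oo --> limn (fun K => \sum_(k < K) u k).
  exact: (cvg_comp (fun K => K * N)%N (fun m => \sum_(j < m) u j) (cvg_mulnr N0) ucvg).
have h2 := cvg_sum_ord bcvg.
apply: (cvg_unique (@Rhausdorff R) h1).
have -> : (fun K => \sum_(j < K * N) u j) =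
    (fun K => \sum_(n < N) \sum_(k < K) u (k * N + n)%N).
  by apply/funext => K; rewrite sum_blocks.
exact: h2.
Qed.

Lemma sumsZ_regroup (a : int -> R) (N : nat) (d C : R) : (0 < N)%N -> 0 < d ->
  (forall k : int, (1 + (k%:~R * d) ^+ 2) * `|a k| <= C) ->
  exists l : 'I_N -> R,
  (forall n : 'I_N, sumsZ (fun k => a (k * N%:Z + n%:Z)) (l n)) /\
  sumsZ a (\sum_(n < N) l n).
Proof.
move=> N0 d0 aC.
have [l1 [m1 [h1 h2 E1]]] := nat_regroup N0 d0 (fun k => aC (Posz k)).
have negC (k : nat) : (1 + (k%:R * d) ^+ 2) * `|a (Negz k)| <= C.
  apply: le_trans (aC (Negz k)); apply: ler_wpM2r => //; rewrite lerD2l.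
  rewrite NegzE mulrNz mulNr sqrrN ler_pXn2r ?nnegrE ?mulr_ge0 ?(ltW d0)//.
  by rewrite ler_pM2r// pmulrn ler_nat.
have [l2 [m2 [g1 g2 E2]]] := nat_regroup N0 d0 negC.
(* On the negative half, - (k + 1) N + n = - (k N + (N - 1 - n)) - 1: residue n sits at offset N - 1
   - n of its block, hence [rev_ord]. *)
exists (fun n => l1 n + l2 (rev_ord n)); split.
  move=> n; exists (l1 n), (l2 (rev_ord n)).
  have E : (fun K => \sum_(k < K) a (Negz k * N%:Z + n%:Z)) =
      (fun K => \sum_(k < K) a (Negz (k * N + rev_ord n)%N)).
    apply/funext => K; apply: eq_bigr => k _; congr a.
    by rewrite !NegzE /=; have := ltn_ord n; lia.
  split=> //; first exact: h1.
  by have := g1 (rev_ord n); rewrite -E.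
exists m1, m2; split => //; rewrite big_split /= -E1; congr (_ + _).
by rewrite E2 [RHS](reindex_inj rev_ord_inj).
Qed.

Lemma csumsZ_regroup (a : int -> R[i]) (N : nat) (d C : R) : (0 < N)%N -> 0 < d ->
  (forall k : int, (1 + (k%:~R * d) ^+ 2) * cabs (a k) <= C) ->
  exists l : 'I_N -> R[i],
  (forall n : 'I_N, csumsZ (fun k => a (k * N%:Z + n%:Z)) (l n)) /\
  csumsZ a (\sum_(n < N) l n).
Proof.
move=> N0 d0 aC.
have ge1 (k : int) : 0 <= 1 + (k%:~R * d) ^+ 2 by rewrite addr_ge0// sqr_ge0.
have [l1 [h1 h2]] := @sumsZ_regroup (fun k => Re (a k)) N d C N0 d0
  (fun k => le_trans (ler_wpM2l (ge1 k) (cabs_Re (a k))) (aC k)).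
have [l2 [g1 g2]] := @sumsZ_regroup (fun k => Im (a k)) N d C N0 d0
  (fun k => le_trans (ler_wpM2l (ge1 k) (cabs_Im (a k))) (aC k)).
exists (fun n => l1 n +i* l2 n); split; first by move=> n; split.
by split; rewrite (cRe_sum, cIm_sum).
Qed.
End sumsZ.

(** * Poisson summation *)

Section riemann_lebesgue.
Variable R : realType.
Local Notation mu := (@lebesgue_measure R).
Implicit Types (f g : R -> R) (a b p : R).

Definition bounded_measurable (D : set R) f :=
  measurable_fun D f /\ exists M : R, forall t, D t -> `|f t| <= M.

Lemma bounded_measurableM D f g : bounded_measurable D f -> bounded_measurable D g ->
  bounded_measurable D (fun t => f t * g t).
Proof.
move=> [fm [M fM]] [gm [K gK]]; split; first exact: measurable_funM.
by exists (M * K) => t Dt; rewrite normrM; apply: ler_pM; rewrite ?fM ?gK.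
Qed.

Lemma bounded_measurableB D f g : bounded_measurable D f -> bounded_measurable D g ->
  bounded_measurable D (fun t => f t - g t).
Proof.
move=> [fm [M fM]] [gm [K gK]]; split; first exact: measurable_funB.
exists (M + K) => t Dt; apply: (le_trans (ler_normB _ _)).
by apply: lerD; rewrite ?fM ?gK.
Qed.

Lemma bounded_measurable_cst D (c : R) : bounded_measurable D (fun=> c).
Proof. by split=> //; exists `|c|. Qed.

Lemma bounded_measurable_integrable a b f : bounded_measurable `[a, b] f ->
  mu.-integrable `[a, b] (EFin \o f).
Proof.
move=> [fm [M fM]].
apply: (@le_integrable _ _ _ mu `[a, b] _ _ (fun=> M%:E)) => //.
- exact/measurable_EFinP.
- by move=> t Dt; rewrite /= lee_fin (le_trans (fM t Dt))// ler_norm.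
- by apply: continuous_integrable => t; exact: cvg_cst.
Qed.

(** Bessel's inequality: the remainder [r n] of g after n projections has a nonnegative square
    integral, which bounds the sum of the squared coefficients. That series converges, so its terms
    tend to 0. *)
Lemma bessel_cvg0 a b (f : nat -> R -> R) g (q : R) : 0 < q ->
  bounded_measurable `[a, b] g -> (forall k, bounded_measurable `[a, b] (f k)) ->
  (forall k l, \int[mu]_(t in `[a, b]) (f k t * f l t) = if k == l then q else 0) ->
  (fun k => \int[mu]_(t in `[a, b]) (g t * f k t)) @ \oo --> (0 : R).
Proof.
move=> q0 gb fb ff.
pose c k := \int[mu]_(t in `[a, b]) (g t * f k t).
pose r n t := g t - \sum_(k < n) c k / q * f k t.
have rS n t : r n.+1 t = r n t - c n / q * f n t.
  by rewrite /r big_ord_recr /= opprD addrA.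
have rb n : bounded_measurable `[a, b] (r n).
  elim: n => [|n IH].
    have -> : r 0%N = g by apply/funext => t; rewrite /r big_ord0 subr0.
    exact: gb.
  have -> : r n.+1 = (fun t => r n t - c n / q * f n t) by apply/funext => t; exact: rS.
  apply: bounded_measurableB => //; apply: bounded_measurableM => //.
  exact: bounded_measurable_cst.
(* The n projections removed so far are orthogonal to [f m]. *)
have rf n m : (n <= m)%N -> \int[mu]_(t in `[a, b]) (r n t * f m t) = c m.
  elim: n => [|n IH] nm.
    by apply: eq_Rintegral => t _; rewrite /r big_ord0 subr0.
  rewrite -(IH (ltnW nm)) -[RHS]subr0.
  have <- : c n / q * \int[mu]_(t in `[a, b]) (f n t * f m t) = 0.
    by rewrite ff ltn_eqF// mulr0.
  have ib : bounded_measurable `[a, b] (fun t => f n t * f m t) by exact: bounded_measurableM.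
  rewrite -RintegralZl//; last exact: bounded_measurable_integrable.
  rewrite -RintegralB//.
  - by apply: eq_Rintegral => t _; rewrite rS; ring.
  - by apply: bounded_measurable_integrable; exact: bounded_measurableM.
  - apply: bounded_measurable_integrable; apply: bounded_measurableM => //.
    exact: bounded_measurable_cst.
have rr n : \int[mu]_(t in `[a, b]) (r n t * r n t) =
    \int[mu]_(t in `[a, b]) (g t * g t) - q^-1 * \sum_(k < n) c k ^+ 2.
  elim: n => [|n IH].
    rewrite big_ord0 mulr0 subr0; apply: eq_Rintegral => t _.
    by rewrite /r big_ord0 subr0.
  rewrite big_ord_recr /= mulrDr opprD addrA -IH.
  have i1 := bounded_measurable_integrable (bounded_measurableM (rb n) (rb n)).
  have i2 := bounded_measurable_integrable (bounded_measurableM (rb n) (fb n)).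
  have i3 := bounded_measurable_integrable (bounded_measurableM (fb n) (fb n)).
  transitivity (\int[mu]_(t in `[a, b]) ((r n t * r n t - 2 * (c n / q) * (r n t * f n t))
      + (c n / q) ^+ 2 * (f n t * f n t))).
    by apply: eq_Rintegral => t _; rewrite rS; ring.
  rewrite RintegralD//; [|exact: integrable_onB (integrable_onZl _ _ _)|exact: integrable_onZl].
  rewrite RintegralB//; last exact: integrable_onZl.
  rewrite !RintegralZl// rf// ff eqxx; field; exact: lt0r_neq0.
have cbound n : \sum_(k < n) c k ^+ 2 <= q * \int[mu]_(t in `[a, b]) (g t * g t).
  rewrite -ler_pdivrMl// -subr_ge0 -rr; apply: Rintegral_ge0 => t _.
  by rewrite -expr2 sqr_ge0.
have cvg2 : cvgn (series (fun k => c k ^+ 2)).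
  apply: nondecreasing_is_cvgn.
    by apply: nondecreasing_series => k _ _; exact: sqr_ge0.
  exists (q * \int[mu]_(t in `[a, b]) (g t * g t)) => _ [n _ <-].
  by rewrite /series /= big_mkord.
have := cvg_series_cvg_0 cvg2 => /cvgrPdist_le H.
apply/cvgrPdist_le => e e0; have e20 : 0 < e ^+ 2 by rewrite exprn_gt0.
near=> k; rewrite sub0r normrN -/(c k).
rewrite -(@ler_pXn2r _ 2) ?nnegrE ?(ltW e0)// real_normK ?num_real//.
have : `|0 - c k ^+ 2| <= e ^+ 2 by near: k; exact: H.
by rewrite sub0r normrN ger0_norm// sqr_ge0.
Unshelve. all: by end_near. Qed.

Lemma sin_int_pi (m : int) : sin (m%:~R * pi) = 0 :> R.
Proof.
have H (n : nat) : sin (n%:R * pi) = 0 :> R.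
  elim: n => [|n IH]; first by rewrite mul0r sin0.
  by rewrite -natr1 mulrDl mul1r sinDpi IH oppr0.
by case: m => n; rewrite ?NegzE ?mulrNz ?mulNr ?sinN H ?oppr0.
Qed.

Lemma Rintegral_cos_period p (m : int) : 0 < p ->
  \int[mu]_(v in `[- (p / 2), p / 2]) cos (2 * pi * m%:~R / p * v) =
  if m == 0 then p else 0.
Proof.
move=> p0; have pp : - (p / 2) <= p / 2 by lra.
case: eqP => [->|/eqP m0].
  rewrite (@eq_Rintegral _ _ _ _ _ (fun=> 1)); last first.
    by move=> v _; rewrite mulr0 !mul0r cos0.
  have h : forall v : R, is_derive v (1 : R) (fun v : R => v) 1 by move=> v; exact: is_derive_id.
  rewrite (@Rintegral_FTC _ (fun v => v) (fun=> 1) _ _ pp _ h); first by lra.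
  by move=> v; exact: cvg_cst.
pose w := 2 * pi * m%:~R / p.
have w0 : w != 0.
  rewrite /w !mulf_neq0// ?invr_eq0 ?intr_eq0// ?gt_eqF ?pi_gt0//.
have wd (v : R) : is_derive v (1 : R) (fun v => w^-1 * sin (w * v)) (cos (w * v)).
  have sd : is_derive v (1 : R) (fun v => sin (w * v)) (cos (w * v) * w).
    exact: (@is_derive1_comp _ sin (fun v => w * v) v _ _ (is_derive_sin _) (is_derive_scale w v)).
  apply: (is_derive_eq (is_deriveZ w^-1 sd)).
  by rewrite /GRing.scale /= mulrC mulfK.
have wc : continuous (fun v : R => cos (w * v)).
  by move=> v; exact: (continuous_comp (@rcontinuous_scale R w v) (@continuous_cos R _)).
rewrite (Rintegral_FTC pp wc wd) mulrN sinN.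
have -> : w * (p / 2) = m%:~R * pi.
  by rewrite /w; move: (pi : R) => u; field; rewrite gt_eqF.
by rewrite sin_int_pi oppr0 subrr.
Qed.

(** Product-to-sum formulas. Frequencies start at 1 because the zero frequency has squared norm p
    for cosines and 0 for sines, not the common value p / 2. *)
Lemma cos_cos_orthogonal p (k l : nat) : 0 < p ->
  \int[mu]_(v in `[- (p / 2), p / 2])
    (cos (2 * pi * k.+1%:R / p * v) * cos (2 * pi * l.+1%:R / p * v)) =
  if k == l then p / 2 else 0.
Proof.
move=> p0.
have ic (m : int) : mu.-integrable `[- (p / 2), p / 2]
    (EFin \o (fun v => cos (2 * pi * m%:~R / p * v))).
  apply: continuous_integrable => v.
  exact: (continuous_comp (@rcontinuous_scale R _ v) (@continuous_cos R _)).
transitivity (\int[mu]_(v in `[- (p / 2), p / 2]) (2^-1 *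
   (cos (2 * pi * (k%:Z - l%:Z)%:~R / p * v) + cos (2 * pi * (k.+1%:Z + l.+1%:Z)%:~R / p * v)))).
  apply: eq_Rintegral => v _.
  have -> : 2 * pi * (k%:Z - l%:Z)%:~R / p * v =
     2 * pi * k.+1%:R / p * v - 2 * pi * l.+1%:R / p * v.
    by rewrite rmorphB /= -!pmulrn -!natr1; ring.
  have -> : 2 * pi * (k.+1%:Z + l.+1%:Z)%:~R / p * v =
     2 * pi * k.+1%:R / p * v + 2 * pi * l.+1%:R / p * v.
    by rewrite rmorphD /= -!pmulrn; ring.
  by rewrite cosB cosD; field.
rewrite RintegralZl//; last by apply: integrable_onD => //; exact: ic.
rewrite RintegralD ?ic// !Rintegral_cos_period// subr_eq0 eqz_nat addr0.
by case: eqP => _; rewrite ?mulr0// mulrC.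
Qed.

Lemma sin_sin_orthogonal p (k l : nat) : 0 < p ->
  \int[mu]_(v in `[- (p / 2), p / 2])
    (sin (2 * pi * k.+1%:R / p * v) * sin (2 * pi * l.+1%:R / p * v)) =
  if k == l then p / 2 else 0.
Proof.
move=> p0.
have ic (m : int) : mu.-integrable `[- (p / 2), p / 2]
    (EFin \o (fun v => cos (2 * pi * m%:~R / p * v))).
  apply: continuous_integrable => v.
  exact: (continuous_comp (@rcontinuous_scale R _ v) (@continuous_cos R _)).
transitivity (\int[mu]_(v in `[- (p / 2), p / 2]) (2^-1 *
   (cos (2 * pi * (k%:Z - l%:Z)%:~R / p * v) - cos (2 * pi * (k.+1%:Z + l.+1%:Z)%:~R / p * v)))).
  apply: eq_Rintegral => v _.
  have -> : 2 * pi * (k%:Z - l%:Z)%:~R / p * v =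
     2 * pi * k.+1%:R / p * v - 2 * pi * l.+1%:R / p * v.
    by rewrite rmorphB /= -!pmulrn -!natr1; ring.
  have -> : 2 * pi * (k.+1%:Z + l.+1%:Z)%:~R / p * v =
     2 * pi * k.+1%:R / p * v + 2 * pi * l.+1%:R / p * v.
    by rewrite rmorphD /= -!pmulrn; ring.
  by rewrite cosB cosD; field.
rewrite RintegralZl//; last by apply: integrable_onB => //; exact: ic.
rewrite RintegralB ?ic// !Rintegral_cos_period// subr_eq0 eqz_nat subr0.
by case: eqP => _; rewrite ?mulr0// mulrC.
Qed.

Lemma continuous_bounded_measurable a b f : continuous f ->
  (exists M : R, forall t, `|f t| <= M) -> bounded_measurable `[a, b] f.
Proof.
move=> fc [M fM]; split; last by exists M.
by apply: measurable_funTS; exact: continuous_measurable_fun.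
Qed.

Lemma riemann_lebesgue p g : 0 < p -> bounded_measurable `[- (p / 2), p / 2] g ->
  (fun k : nat => \int[mu]_(v in `[- (p / 2), p / 2])
     (g v * cos (2 * pi * k%:R / p * v))) @ \oo --> (0 : R) /\
  (fun k : nat => \int[mu]_(v in `[- (p / 2), p / 2])
     (g v * sin (2 * pi * k%:R / p * v))) @ \oo --> (0 : R).
Proof.
move=> p0 gb; have p20 : 0 < p / 2 by rewrite divr_gt0.
split; rewrite -(cvg_shiftS).
  apply: (bessel_cvg0 p20 gb) => [k|k l]; last exact: cos_cos_orthogonal.
  apply: continuous_bounded_measurable.
    by move=> v; exact: (continuous_comp (@rcontinuous_scale R _ v) (@continuous_cos R _)).
  by exists 1 => t; rewrite ler_norml cos_geN1 cos_le1.
apply: (bessel_cvg0 p20 gb) => [k|k l]; last exact: sin_sin_orthogonal.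
apply: continuous_bounded_measurable.
  by move=> v; exact: (continuous_comp (@rcontinuous_scale R _ v) (@continuous_sin R _)).
by exists 1 => t; rewrite ler_norml sin_geN1 sin_le1.
Qed.

(** Chernoff's quotient divides by a sine vanishing at 0, so inversion must be measurable across its
    discontinuity. *)
Lemma measurable_inv : measurable_fun setT (GRing.inv : R -> R).
Proof.
have -> : setT = [set 0 : R] `|` ~` [set 0 : R] by rewrite setUv.
apply/measurable_funU => //; first exact: measurableC.
split; first exact: measurable_fun_set1.
apply: open_continuous_measurable_fun.
  exact/closed_openC.
move=> y; rewrite inE => y0; apply: inv_continuous; exact/eqP.
Qed.

(** A weak Jordan inequality. With z = y / 2 <= pi / 4, sin y = 2 sin z cos z, where sin z >= z
    cos(pi / 4), cos z >= cos(pi / 4), and cos(pi / 4)^2 = 1/2. *)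
Lemma sin_ge_half (y : R) : 0 <= y <= pi / 2 -> y / 2 <= sin y.
Proof.
move=> /andP[y0 yp]; pose z := y / 2.
have z0 : 0 <= z by rewrite divr_ge0.
have p0 : 0 < pi :> R by exact: pi_gt0.
have zp : z <= pi / 4 by rewrite /z; move: yp; move: (pi : R) => u; lra.
have ce (u : R) : 0 <= u <= pi / 4 -> cos (pi / 4) <= cos u.
  move=> /andP[u0]; rewrite le_eqVlt => /predU1P[->//|up].
  rewrite ltW// ltr_cos// in_itv /=; apply/andP; split; move: up u0 p0;
    by move: (pi : R) => w; lra.
have c1 : cos (pi / 4) <= cos z by apply: ce; rewrite z0.
have c0 : 0 <= cos (pi / 4 : R).
  by rewrite cos_ge0_pihalf//; apply/andP; split; move: p0; move: (pi : R) => w; lra.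
have c2 : cos (pi / 4) ^+ 2 = 2^-1 :> R.
  have := cos_pihalf R; have -> : pi / 2 = (pi / 4) *+ 2 :> R.
    by move: (pi : R) => w; rewrite -mulr_natr; lra.
  rewrite cos_mulr2n => /eqP; rewrite subr_eq0 => /eqP H.
  by move: H; rewrite -mulr_natr; lra.
have s1 : z * cos (pi / 4) <= sin z.
  have [c cz E] := @MVT_segment R sin cos 0 z z0 (fun x _ => is_derive_sin x)
    (continuous_subspaceT (@continuous_sin R)).
  move: E; rewrite sin0 !subr0 => ->; rewrite mulrC; apply: ler_wpM2r => //.
  by apply: ce; move: cz; rewrite in_itv /= => /andP[-> /le_trans]; apply.
have -> : y = z *+ 2 by rewrite /z -mulr_natr; lra.
rewrite sin_mulr2n [z *+ 2 / 2](_ : _ = z); last first.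
  by rewrite -mulr_natr; lra.
have : z * cos (pi / 4) * cos (pi / 4) <= sin z * cos z.
  by apply: ler_pM => //; rewrite mulr_ge0.
rewrite -mulrA -expr2 c2 -mulr_natr.
by clearbody z; lra.
Qed.
End riemann_lebesgue.

Section point_lipschitz.
Variable R : realType.
Implicit Types (h g : R -> R[i]).

(** The constant may depend on the base point a. This makes the notion stable under multiplication
    of a bounded function by the unbounded v, where a uniform Lipschitz constant could be lost. *)
Definition point_lipschitz h := forall a, exists C : R,
  forall v, cabs (h (a + v) - h a) <= C * `|v|.

Lemma point_lipschitzD h g : point_lipschitz h -> point_lipschitz g ->
  point_lipschitz (fun v => h v + g v).
Proof.
move=> hl gl a; have [C HC] := hl a; have [K HK] := gl a.
exists (C + K) => v; rewrite opprD addrACA [leRHS]mulrDl.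
by apply: le_trans (cabsD _ _) _; exact: lerD.
Qed.

Lemma point_lipschitzM h g (M : R) : (forall t, cabs (h t) <= M) ->
  point_lipschitz h -> point_lipschitz g -> point_lipschitz (fun v => h v * g v).
Proof.
move=> hM hl gl a; have [C HC] := hl a; have [K HK] := gl a.
exists (M * K + C * cabs (g a)) => v.
have -> : h (a + v) * g (a + v) - h a * g a =
  h (a + v) * (g (a + v) - g a) + (h (a + v) - h a) * g a by ring.
apply: le_trans (cabsD _ _) _; rewrite [leRHS]mulrDl; apply: lerD.
  apply: le_trans (cabsM _ _) _; rewrite -mulrA.
  by apply: ler_pM; rewrite ?cabs_ge0.
by apply: le_trans (cabsM _ _) _; rewrite mulrAC; apply: ler_wpM2r; rewrite ?cabs_ge0.
Qed.

Lemma point_lipschitz_expj (c : R) : point_lipschitz (fun v => expj (c * v)).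
Proof.
move=> a; exists (2 * `|c|) => v; apply: le_trans (cabs_expjB _ _) _.
by rewrite -mulrBr addrAC subrr add0r normrM mulrA.
Qed.

Lemma point_lipschitz_linear (z : R[i]) : point_lipschitz (fun v => z * v%:C).
Proof.
move=> a; exists (cabs z) => v; rewrite -mulrBr; apply: le_trans (cabsM _ _) _.
have -> : (a + v)%:C - a%:C = v%:C.
  by apply: ceqP; rewrite (cReD, cImD) (cReN, cImN) /= ?subrr// addrAC subrr add0r.
by rewrite cabs_real.
Qed.
End point_lipschitz.

(** * Fourier coefficients, Chernoff's argument and the summation formula *)

Section poisson_summation.
Variable R : realType.
Local Notation mu := (@lebesgue_measure R).
Local Notation Re := (@complex.Re R).
Local Notation Im := (@complex.Im R).
Implicit Types (h g : R -> R[i]) (a b p v : R).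

Lemma cintegral_blocks h a p (n : nat) : 0 < p -> ccontinuous h ->
  cintegral_on `[a, a + n%:R * p] h =
  \sum_(i < n) cintegral_on `[- (p / 2), p / 2] (fun v => h (v + (a + p / 2 + i%:R * p))).
Proof.
move=> p0 hc; elim: n => [|n IH].
  rewrite big_ord0 mul0r addr0 set_itv1; apply: ceqP => /=; exact: Rintegral_set1.
have np : 0 <= n%:R * p by rewrite mulr_ge0// ltW.
rewrite big_ord_recr /= -IH (@cintegral_chasles _ _ _ (a + n%:R * p))//; last 2 first.
- by rewrite lerDl.
- by rewrite -natr1; lra.
congr (_ + _); rewrite cintegral_shift//; last by lra.
have -> : - (p / 2) + (a + p / 2 + n%:R * p) = a + n%:R * p by ring.
have -> // : p / 2 + (a + p / 2 + n%:R * p) = a + n.+1%:R * p by rewrite -[n.+1%:R]natr1; lra.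
Qed.

(** Each half telescopes on its own, leaving u(- 1) and - u(- 1), which cancel. *)
Lemma sumsZ_telescope (a u : int -> R) : (forall k, a k = u (k - 1) - u k) ->
  (fun n : nat => u n%:Z) @ \oo --> (0 : R) ->
  (fun n : nat => u (- n%:Z)) @ \oo --> (0 : R) -> sumsZ a 0.
Proof.
move=> aE u1 u2.
have E1 n : \sum_(k < n) a (Posz k) = u (- 1) - u (n%:Z - 1).
  elim: n => [|n IH]; first by rewrite big_ord0 sub0r subrr.
  rewrite big_ord_recr /= IH aE.
  have -> : (n.+1%:Z - 1 = n%:Z)%R by lia.
  by ring.
have E2 n : \sum_(k < n) a (Negz k) = u (- (n.+1%:Z)) - u (- 1).
  elim: n => [|n IH]; first by rewrite big_ord0 subrr.
  rewrite big_ord_recr /= IH aE.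
  have -> : (Negz n - 1 = - n.+2%:Z)%R by lia.
  have -> : (Negz n = - n.+1%:Z)%R by lia.
  by ring.
exists (u (- 1) - 0), (0 - u (- 1)); split; last by ring.
  under eq_fun do rewrite E1; apply: cvgB; first exact: cvg_cst.
  rewrite -cvg_shiftS; suff -> : [sequence u (n.+1%:Z - 1)%R]_n = (fun n : nat => u n%:Z) by [].
  by apply/funext => n /=; congr u; lia.
under eq_fun do rewrite E2; apply: cvgB; last exact: cvg_cst.
by have := u2; rewrite -cvg_shiftS.
Qed.

(** The k-th Fourier coefficient over one period, without the customary factor 1 / p. *)
Definition fcoef p g (k : int) : R[i] :=
  cintegral_on `[- (p / 2), p / 2] (fun v => g v * expj (- (2 * pi * k%:~R / p * v))).

Lemma riemann_lebesgue_complex p g : 0 < p ->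
  bounded_measurable `[- (p / 2), p / 2] (fun v => Re (g v)) ->
  bounded_measurable `[- (p / 2), p / 2] (fun v => Im (g v)) ->
  [/\ (fun n : nat => Re (fcoef p g n%:Z)) @ \oo --> (0 : R),
      (fun n : nat => Im (fcoef p g n%:Z)) @ \oo --> (0 : R),
      (fun n : nat => Re (fcoef p g (- n%:Z))) @ \oo --> (0 : R) &
      (fun n : nat => Im (fcoef p g (- n%:Z))) @ \oo --> (0 : R)].
Proof.
move=> p0 g1 g2.
have [c1 s1] := riemann_lebesgue p0 g1; have [c2 s2] := riemann_lebesgue p0 g2.
pose J (u : R -> R) (f : R -> R) (n : nat) :=
  \int[mu]_(v in `[- (p / 2), p / 2]) (u v * f (2 * pi * n%:R / p * v)).
have bc (n : nat) : bounded_measurable `[- (p / 2), p / 2] (fun v => cos (2 * pi * n%:R / p * v)).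
  apply: continuous_bounded_measurable.
    by move=> v; exact: (continuous_comp (@rcontinuous_scale R _ v) (@continuous_cos R _)).
  by exists 1 => t; rewrite ler_norml cos_geN1 cos_le1.
have bs (n : nat) : bounded_measurable `[- (p / 2), p / 2] (fun v => sin (2 * pi * n%:R / p * v)).
  apply: continuous_bounded_measurable.
    by move=> v; exact: (continuous_comp (@rcontinuous_scale R _ v) (@continuous_sin R _)).
  by exists 1 => t; rewrite ler_norml sin_geN1 sin_le1.
have ii u f : bounded_measurable `[- (p / 2), p / 2] u ->
   bounded_measurable `[- (p / 2), p / 2] f ->
   mu.-integrable `[- (p / 2), p / 2] (EFin \o (fun v => u v * f v)).
  by move=> ub fb; apply: bounded_measurable_integrable; exact: bounded_measurableM.
have E1 n : Re (fcoef p g n%:Z) = J (fun v => Re (g v)) cos n + J (fun v => Im (g v)) sin n.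
  rewrite /J -RintegralD//; [|exact: ii..].
  by apply: eq_Rintegral => v _; rewrite cReM /= cosN sinN -pmulrn; ring.
have E2 n : Im (fcoef p g n%:Z) = J (fun v => Im (g v)) cos n - J (fun v => Re (g v)) sin n.
  rewrite /J -RintegralB//; [|exact: ii..].
  by apply: eq_Rintegral => v _; rewrite cImM /= cosN sinN -pmulrn; ring.
have E3 n : Re (fcoef p g (- n%:Z)) = J (fun v => Re (g v)) cos n - J (fun v => Im (g v)) sin n.
  rewrite /J -RintegralB//; [|exact: ii..].
  apply: eq_Rintegral => v _; rewrite cReM /= mulrNz mulrN !mulNr opprK -pmulrn.
  by ring.
have E4 n : Im (fcoef p g (- n%:Z)) = J (fun v => Im (g v)) cos n + J (fun v => Re (g v)) sin n.
  rewrite /J -RintegralD//; [|exact: ii..].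
  apply: eq_Rintegral => v _; rewrite cImM /= mulrNz mulrN !mulNr opprK -pmulrn.
  by ring.
split.
- under eq_fun do rewrite E1.
  have H := cvgD c1 s2; rewrite addr0 in H; exact: H.
- under eq_fun do rewrite E2.
  have H := cvgB c2 s1; rewrite subr0 in H; exact: H.
- under eq_fun do rewrite E3.
  have H := cvgB c1 s2; rewrite subr0 in H; exact: H.
- under eq_fun do rewrite E4.
  have H := cvgD c2 s1; rewrite addr0 in H; exact: H.
Qed.

Lemma expj_int (m : int) : expj (2 * pi * m%:~R) = 1 :> R[i].
Proof.
have H (n : nat) : expj (2 * pi * n%:R) = 1 :> R[i].
  elim: n => [|n IH]; first by rewrite mulr0 expj0.
  rewrite -[n.+1%:R]natr1 mulrDr mulr1 expjD IH mul1r.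
  by rewrite /expj mulr_natl cos2pi sin2pi.
case: m => n; first exact: H.
rewrite NegzE mulrNz mulrN -[LHS]mulr1 -{1}(H n.+1) -expjD.
by rewrite addNr expj0.
Qed.

Lemma fcoef_cst p (z : R[i]) (k : int) : 0 < p ->
  fcoef p (fun=> z) k = if k == 0 then p%:C * z else 0.
Proof.
move=> p0; pose w := 2 * pi * k%:~R / p.
have ic : cintegrable_on `[- (p / 2), p / 2] (fun v => expj (- (w * v))).
  apply: ccontinuous_integrable; under eq_fun do rewrite -mulNr.
  exact: ccontinuous_expj_scale.
rewrite /fcoef cintegral_onZ// mulrC -/w.
have -> : cintegral_on `[- (p / 2), p / 2] (fun v => expj (- (w * v))) =
   (if k == 0 then p else 0)%:C.
  apply: ceqP => /=.
    rewrite -(Rintegral_cos_period k p0) -/w.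
    by apply: eq_Rintegral => v _; rewrite cosN.
  have pp : - (p / 2) <= p / 2 by lra.
  have sc : continuous (fun v => sin (- w * v)).
    by move=> v; exact: (continuous_comp (@rcontinuous_scale R _ v) (@continuous_sin R _)).
  transitivity (\int[mu]_(v in `[- (p / 2), p / 2]) sin (- w * v)).
    by apply: eq_Rintegral => v _; rewrite mulNr.
  have H := Rintegral_opp pp sc; move: H; rewrite opprK => H.
  have si : mu.-integrable `[- (p / 2), p / 2] (EFin \o (fun v => sin (- w * v))).
    exact: continuous_integrable.
  have : \int[mu]_(t in `[- (p / 2), p / 2]) sin (- w * - t) =
      (- 1) * \int[mu]_(v in `[- (p / 2), p / 2]) sin (- w * v).
    rewrite -RintegralZl//; apply: eq_Rintegral => v _.
    by rewrite mulrN sinN mulN1r.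
  by rewrite H; move: (Rintegral _ _ _) => u; lra.
by case: eqP => // _; rewrite mul0r.
Qed.

Section summation.
Variables (p : R) (Psi : R -> R[i]).
Hypothesis p0 : 0 < p.
Hypothesis Psi_cont : ccontinuous Psi.
Hypothesis Psi_cs : compactly_supported Psi.
Hypothesis Psi_lip : point_lipschitz Psi.

(** A finite sum suffices near 0 since Psi has compact support. The shifts run from - M to M - 1,
    matching the first M [Posz] and the first M [Negz] indices. *)
Definition periodization (M : nat) v :=
  \sum_(i < M + M) Psi (v + (i%:R - M%:R) * p).

Lemma periodization_ccontinuous M : ccontinuous (periodization M).
Proof.
apply: (@ccontinuous_sum _ (M + M) (fun i v => Psi (v + (i%:R - M%:R) * p))) => i.
exact: (ccontinuous_comp Psi_cont (@rcontinuous_shift R _)).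
Qed.

Lemma periodization_lip M : exists2 C : R, 0 <= C &
  forall v, cabs (periodization M v - periodization M 0) <= C * `|v|.
Proof.
rewrite /periodization; elim: (M + M)%N => [|n [C C0 HC]].
  by exists 0 => // v; rewrite !big_ord0 subrr cabs0 mul0r.
have [K HK] := Psi_lip ((n%:R - M%:R) * p).
exists (C + `|K|) => [|v]; first exact: addr_ge0.
rewrite !big_ord_recr /= opprD addrACA [leRHS]mulrDl; apply: le_trans (cabsD _ _) _.
apply: lerD => //; rewrite add0r [v + _]addrC; apply: le_trans (HK v) _.
by apply: ler_wpM2r => //; exact: ler_norm.
Qed.

Lemma periodization0 (M : nat) (B : R) : (forall t, B < `|t| -> Psi t = 0) -> B < M%:R * p ->
  csumsZ (fun j => Psi (j%:~R * p)) (periodization M 0).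
Proof.
move=> PB BM.
have -> : periodization M 0 =
   \sum_(k < M) Psi ((Posz k)%:~R * p) + \sum_(k < M) Psi ((Negz k)%:~R * p).
  rewrite /periodization big_split_ord /= addrC; congr (_ + _).
    by apply: eq_bigr => i _; rewrite natrD addrAC subrr !add0r -pmulrn.
  rewrite [RHS](reindex_inj rev_ord_inj) /=; apply: eq_bigr => i _.
  congr Psi; rewrite add0r NegzE mulrNz; congr (_ * p).
  by rewrite -pmulrn subnSK// natrB ?opprB// ltnW.
apply: (@csumsZ_finite _ (fun j => Psi (j%:~R * p))) => k Mk; apply: PB.
  rewrite -pmulrn normrM normr_nat gtr0_norm//; apply: lt_le_trans BM _.
  by rewrite ler_pM2r// ler_nat.
rewrite NegzE mulrNz mulNr normrN -pmulrn normrM normr_nat gtr0_norm//.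
apply: lt_le_trans BM _; by rewrite ler_pM2r// ler_nat ltnW.
Qed.

(** Unfolding: the line is cut into cells of length p, and e^{- 2 pi j k v / p} has period p, so all
    cells are summed under one exponential. *)
Lemma fourier_periodization (M : nat) (B : R) (k : int) : (forall t, B < `|t| -> Psi t = 0) ->
  B < M%:R * p - p / 2 ->
  fourier_fun Psi (k%:~R / p) = fcoef p (periodization M) k.
Proof.
move=> PB BM.
pose e v : R[i] := expj (- (2 * pi * (k%:~R / p)) * v).
pose h v := Psi v * e v.
have ec : ccontinuous e by exact: ccontinuous_expj_scale.
have hc : ccontinuous h by exact: ccontinuousM.
(* The 2 M cells centred at (i - M) p fill [- M p - p / 2, M p - p / 2]; the bound on B places the
   support of Psi inside. *)
pose a := - (M%:R * p) - p / 2.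
have Mp : 0 <= M%:R * p by rewrite mulr_ge0// ltW.
have -> : fourier_fun Psi (k%:~R / p) = cintegral h.
  by congr cintegral; apply/funext => v; rewrite /h /e mulNr.
rewrite (@cintegral_interval _ _ a (a + (M + M)%:R * p)); last 2 first.
- by rewrite lerDl mulr_ge0// ltW.
- move=> t tB; rewrite /h PB ?mul0r// ltNge; apply/negP => tB'.
  move/negP : tB; apply; move: tB'; rewrite ler_norml /a [(M + M)%:R]natrD => /andP[tB1 tB2].
  rewrite mulrDl; move: tB1 tB2 BM p0; move: (M%:R * p) => q *.
  by apply/andP; split; lra.
rewrite cintegral_blocks// /fcoef.
rewrite -(@cintegral_on_sum _ _ (M + M)
  (fun i v => h (v + (a + p / 2 + i%:R * p))))//; last first.
  move=> i _; apply: ccontinuous_integrable.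
  exact: (ccontinuous_comp hc (@rcontinuous_shift R _)).
apply: eq_cintegral_on => v _; rewrite /periodization mulr_suml.
apply: eq_bigr => i _; rewrite /h /e.
have -> : a + p / 2 + i%:R * p = (i%:R - M%:R) * p by rewrite /a; ring.
congr (_ * _).
have -> : - (2 * pi * (k%:~R / p)) * (v + (i%:R - M%:R) * p) =
   - (2 * pi * k%:~R / p * v) + 2 * pi * (- (k * (i%:Z - M%:Z)))%:~R.
  rewrite mulrNz rmorphM rmorphB /= -!pmulrn; move: (pi : R) => q; field.
  by rewrite gt_eqF.
by rewrite expjD expj_int mulr1.
Qed.

(* Chernoff's argument: with Q := P - P(0) = (e^{2 pi j v / p} - 1) g, the k-th
   Fourier coefficient of Q is the difference of two consecutive coefficients of
   g, which tend to 0 because g is bounded. *)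
Lemma chernoff_summation (Q : R -> R[i]) (C : R) : ccontinuous Q -> 0 <= C ->
  (forall v, cabs (Q v) <= C * `|v|) -> csumsZ (fcoef p Q) 0.
Proof.
move=> Qc C0 QC; have pi0 : 0 < pi :> R by exact: pi_gt0.
(* Since e^{2 pi j v / p} - 1 = 2 j s(v) e^{pi j v / p}, g is Q divided by this factor. At v = 0,
   where the division degenerates, Q and g are both 0. *)
pose s v := sin (pi / p * v).
pose g v := Q v * (expj (- (pi / p) * v) * (- (2 * s v)^-1 *i)).
have Q0 : Q 0 = 0.
  by apply: cabs_le0; apply: le_trans (QC 0) _; rewrite normr0 mulr0.
have sI v : - (p / 2) <= v <= p / 2 -> pi / p * `|v| / 2 <= `|s v|.
  move=> vI; have vp : `|v| <= p / 2 by rewrite ler_norml.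
  have -> : `|s v| = `|sin (pi / p * `|v|)|.
    by rewrite /s; case: (ger0P v) => // _; rewrite mulrN sinN normrN.
  apply: le_trans (ler_norm _); apply: sin_ge_half; apply/andP; split.
    by rewrite mulr_ge0// divr_ge0// ltW.
  have -> : pi / 2 = pi / p * (p / 2) :> R.
    by move: (pi : R) => q; field; rewrite gt_eqF.
  by apply: ler_wpM2l => //; rewrite divr_ge0// ltW.
have sc : continuous s.
  by move=> v; exact: (continuous_comp (@rcontinuous_scale R _ v) (@continuous_sin R _)).
have gm : cmeasurable `[- (p / 2), p / 2] g.
  apply: cmeasurableM; first exact: ccontinuous_cmeasurable.
  apply: cmeasurableM.
    by apply: ccontinuous_cmeasurable => //; exact: ccontinuous_expj_scale.
  split => /=; first exact: measurable_cst.
  apply: measurable_funTS; apply: (measurableT_comp (f := @GRing.opp R)) => //.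
  apply: (measurableT_comp (@measurable_inv R)).
  by apply: measurable_funM => //; exact: continuous_measurable_fun.
(* The zero of Q at 0 compensates that of the sine: C |v| / |s v| <= 2 C p / pi. *)
pose D := C * (2 * (p / pi)).
have gb v : - (p / 2) <= v <= p / 2 -> cabs (g v) <= D.
  move=> vI; have [->|v0] := eqVneq v 0.
    rewrite /g Q0 mul0r cabs0 /D mulr_ge0// mulr_ge0// divr_ge0//; exact: ltW.
  have v0' : 0 < `|v| by rewrite normr_gt0.
  have := sI v vI; set y := `|s v| => sy.
  have pv0 : 0 < pi / p * `|v| / 2 by rewrite !(divr_gt0, mulr_gt0).
  have y0 : 0 < y by exact: lt_le_trans sy.
  apply: le_trans (cabsM _ _) _.
  apply: (@le_trans _ _ (C * `|v| * (2 * (2 * y)^-1))).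
    apply: ler_pM; [exact: cabs_ge0|exact: cabs_ge0|exact: QC|].
    apply: le_trans (cabsM _ _) _.
    apply: ler_pM; [exact: cabs_ge0|exact: cabs_ge0|exact: cabs_expj|].
    by rewrite cabsN cabs_i normfV normrM (ger0_norm (_ : 0 <= 2)).
  rewrite /D -mulrA; apply: ler_wpM2l => //.
  have -> : `|v| * (2 * (2 * y)^-1) = `|v| / y.
    by field; rewrite gt_eqF.
  rewrite ler_pdivrMr//.
  apply: (@le_trans _ _ (2 * (p / pi) * (pi / p * `|v| / 2))).
    rewrite le_eqVlt; apply/orP; left; apply/eqP.
    move: (pi : R) pi0 => q q0; field.
    by rewrite !gt_eqF.
  by apply: ler_wpM2l => //; rewrite mulr_ge0// divr_ge0// ltW.
have [gm1 gm2] := gm.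
have b1 : bounded_measurable `[- (p / 2), p / 2] (fun v => Re (g v)).
  split=> //; exists D => v /=; rewrite in_itv => vI.
  exact: le_trans (cabs_Re _) (gb v vI).
have b2 : bounded_measurable `[- (p / 2), p / 2] (fun v => Im (g v)).
  split=> //; exists D => v /=; rewrite in_itv => vI.
  exact: le_trans (cabs_Im _) (gb v vI).
have gi : cintegrable_on `[- (p / 2), p / 2] g.
  by split; exact: bounded_measurable_integrable.
have gei (k : int) : cintegrable_on `[- (p / 2), p / 2]
    (fun v => g v * expj (- (2 * pi * k%:~R / p * v))).
  apply: (@eq_cintegrable_on R _ (fun v => expj (- (2 * pi * k%:~R / p * v)) * g v)) => //.
    by move=> v _; exact: mulrC.
  apply: (@cintegrable_onM R _ g (fun v => expj (- (2 * pi * k%:~R / p * v))) 2) => //;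
    last by move=> t _; exact: cabs_expj.
  apply: ccontinuous_cmeasurable => //; under eq_fun do rewrite -mulNr.
  exact: ccontinuous_expj_scale.
have QE (k : int) : fcoef p Q k = fcoef p g (k - 1) - fcoef p g k.
  rewrite /fcoef -cintegral_onB//; apply: eq_cintegral_on => v /=; rewrite in_itv => vI.
  have [->|v0] := eqVneq v 0; first by rewrite /g Q0 !mul0r subrr.
  have s0 : s v != 0.
    rewrite -normr_gt0; apply: lt_le_trans (sI v vI).
    by rewrite !(divr_gt0, mulr_gt0)// normr_gt0.
  rewrite -mulrBr; have -> : - (2 * pi * (k - 1)%:~R / p * v) =
    - (2 * pi * k%:~R / p * v) + pi / p * v + pi / p * v.
    by rewrite rmorphB /=; ring.
  rewrite /g -[RHS]mulrA; congr (_ * _).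
  rewrite !expjD -[X in _ - X]mulr1.
  have <- : expj (- (pi / p) * v) * expj (pi / p * v) = 1 :> R[i].
    by rewrite -expjD mulNr addNr expj0.
  set E := expj (- (2 * pi * k%:~R / p * v)).
  set F := expj (pi / p * v); set F' := expj (- (pi / p) * v).
  have FF : F * F' = 1 by rewrite -expjD mulNr addrN expj0.
  have FB : F - F' = (2 * s v) *i.
    apply: ceqP; rewrite (cReD, cImD) (cReN, cImN) /= mulNr ?cosN ?sinN ?subrr//.
    by rewrite opprK /s; ring.
  have -> : F' * (- (2 * s v)^-1 *i) * (E * F * F - E * (F' * F)) =
    (F * F') * (E * ((- (2 * s v)^-1 *i) * (F - F'))) by ring.
  rewrite FF mul1r FB.
  have -> : (- (2 * s v)^-1 *i) * ((2 * s v) *i) = 1 :> R[i].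
    have s2 : 2 * s v != 0 by rewrite mulf_neq0.
    by rewrite mulNr; apply: ceqP => /=; rewrite ?mulVf// ?mul0r ?mulr0 ?addr0 ?oppr0// sub0r opprK.
  by rewrite mulr1.
have [l1 l2 l3 l4] := riemann_lebesgue_complex p0 b1 b2.
split=> /=.
  apply: (@sumsZ_telescope (fun k => Re (fcoef p Q k)) (fun k => Re (fcoef p g k)) _ l1 l3).
  by move=> k; rewrite QE cReD cReN.
apply: (@sumsZ_telescope (fun k => Im (fcoef p Q k)) (fun k => Im (fcoef p g k)) _ l2 l4).
by move=> k; rewrite QE cImD cImN.
Qed.

(** The samples of F Psi are Fourier coefficients of the periodization P. The part P - P(0) sums to
    0 by Chernoff's argument, and the constant P(0) contributes p P(0) at k = 0 only. *)
Lemma poisson_summation : exists S : R[i],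
  csumsZ (fun j => Psi (j%:~R * p)) S /\
  csumsZ (fun k => fourier_fun Psi (k%:~R / p)) (p%:C * S).
Proof.
have [B PB] := Psi_cs.
pose M := Num.bound ((`|B| + p / 2) / p).
have BM : B < M%:R * p - p / 2.
  have : (`|B| + p / 2) / p < M%:R.
    apply: archi_boundP; apply: divr_ge0; last exact: ltW.
    by apply: addr_ge0 => //; apply: divr_ge0 => //; exact: ltW.
  by rewrite ltr_pdivrMr//; have := ler_norm B; lra.
exists (periodization M 0); split.
  by apply: (periodization0 PB); move: BM p0; move: (M%:R * p) => q *; lra.
have Pc := periodization_ccontinuous M.
have [C C0 HC] := periodization_lip M.
pose Q v := periodization M v + (- periodization M 0).
have Qc : ccontinuous Q by apply: ccontinuousD => //; exact: ccontinuous_cst.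
have H1 := chernoff_summation Qc C0 HC.
have H2 : csumsZ (fcoef p (fun=> periodization M 0)) (p%:C * periodization M 0).
  have := @csumsZ_finite _ (fcoef p (fun=> periodization M 0)) 1.
  rewrite !big_ord1 !fcoef_cst//= addr0; apply => -[|k]// _.
    by rewrite fcoef_cst.
  by rewrite fcoef_cst.
have -> : (fun k : int => fourier_fun Psi (k%:~R / p)) =
  (fun k => fcoef p Q k + fcoef p (fun=> periodization M 0) k).
  apply/funext => k; rewrite (fourier_periodization k PB BM) /fcoef -cintegral_onD//.
  - by apply: eq_cintegral_on => v _; rewrite /Q -mulrDl subrK.
  - apply: ccontinuous_integrable; apply: ccontinuousM => //.
    by under eq_fun do rewrite -mulNr; exact: ccontinuous_expj_scale.
  - apply: ccontinuous_integrable; apply: ccontinuousM; first exact: ccontinuous_cst.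
    by under eq_fun do rewrite -mulNr; exact: ccontinuous_expj_scale.
by rewrite -[X in csumsZ _ X]add0r; exact: csumsZD.
Qed.

End summation.
End poisson_summation.

(** * The interleaved spectrum *)

Section interleaved_spectrum.
Variables (R : realType) (fmax : R) (x : R -> R[i]) (X : distr R).
Hypothesis x_cont : ccontinuous x.
Hypothesis x_temp : tempered_fun x.
Hypothesis X_fourier : X =d fourier (distr_of_fun x).
Hypothesis x_band : band_limited fmax X.
Implicit Types (phi : R -> R[i]) (s t tau v p : R).

Lemma expj_lin (c : R) : (fun u : R => expj (- (2 * pi * u * c))) = (fun u => expj (- (2 * pi * c) * u)).
Proof. by apply/funext => u; congr expj; ring. Qed.

Lemma fourier_skewed_spectrum phi s t : test_function phi ->
  fourier_fun (fun v => X (fun u => expj (- (2 * pi * u * s)) * phi (u + v))) t =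
  x (t - s) * fourier_fun phi t.
Proof.
move=> pt; pose phis u := expj (- (2 * pi * u * s)) * phi u.
have pst : test_function phis.
  by apply: test_functionM => //; rewrite expj_lin; exact: csmooth_expj.
(* The exponential is taken at u, not at u + v. The compensating factor e^{2 pi j v s} moves time
   from t to t - s, and the modulation inside [phis] moves it back in the factor F phi alone,
   leaving x at t - s. *)
have -> : (fun v => X (fun u => expj (- (2 * pi * u * s)) * phi (u + v))) =
    (fun v => expj (- (2 * pi * v * - s)) * spectrum_shift X phis v).
  apply/funext => v; rewrite /spectrum_shift.
  rewrite -(spectrumZ x_temp X_fourier _ (test_function_shift v pst)).
  congr X; apply/funext => u; rewrite /phis mulrA -expjD; congr (expj _ * _).
  by ring.
rewrite (fourier_modulate (spectrum_shift X phis) (- s)).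
rewrite (fourier_spectrum_shift x_cont x_temp X_fourier x_band)//.
by rewrite /wsignal (fourier_modulate phi s) subrK.
Qed.

(* The pairing of 2 pi j f X(f) with phi(. + v); the frequency comb of the
   statement samples this function of v. *)
Definition deriv_shift phi v : R[i] :=
  X (fun u => (2 * pi * u) *i * phi (u + v)).

Lemma linear_iE (u : R) : (2 * pi * u) *i = ((2 * pi) *i) * u%:C.
Proof. by apply: ceqP => /=; ring. Qed.

Lemma csmooth_linear_i : csmooth (fun u : R => (2 * pi * u) *i).
Proof.
have -> : (fun u : R => (2 * pi * u) *i) = (fun u => ((2 * pi) *i) * u%:C).
  by apply/funext => u; exact: linear_iE.
by apply: csmoothM; [exact: csmooth_cst|exact: csmooth_id].
Qed.

(** Writing u = (u + v) - v splits the pairing into a shift of one fixed test function and v times a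
    shift of phi. *)
Lemma deriv_shiftE phi v : test_function phi ->
  deriv_shift phi v = spectrum_shift X (fun u => (2 * pi * u) *i * phi u) v +
    (- ((2 * pi) *i) * v%:C) * spectrum_shift X phi v.
Proof.
move=> pt; rewrite /deriv_shift /spectrum_shift.
have pst : test_function (fun u => (2 * pi * u) *i * phi u).
  by apply: test_functionM => //; exact: csmooth_linear_i.
have st := test_function_shift v pt.
rewrite -(spectrumZ x_temp X_fourier _ st).
rewrite -(spectrumD x_temp X_fourier (test_function_shift v pst) (test_functionZ _ st)).
congr X; apply/funext => u; rewrite !linear_iE -mulrDl; congr (_ * _).
by apply: ceqP => /=; ring.
Qed.

Lemma deriv_shift_regular phi : test_function phi ->
  [/\ ccontinuous (deriv_shift phi), compactly_supported (deriv_shift phi) &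
      point_lipschitz (deriv_shift phi)].
Proof.
move=> pt; pose psi u := (2 * pi * u) *i * phi u.
have qt : test_function psi by apply: test_functionM => //; exact: csmooth_linear_i.
have -> : deriv_shift phi = (fun v => spectrum_shift X psi v +
    spectrum_shift X phi v * (- ((2 * pi) *i) * v%:C)).
  by apply/funext => v; rewrite deriv_shiftE// [in RHS]mulrC.
have gl psi' : test_function psi' -> point_lipschitz (spectrum_shift X psi').
  move=> qt' a; have [C HC] := spectrum_shift_lipschitz x_temp X_fourier qt'.
  by exists C => v; apply: le_trans (HC _ _) _; rewrite addrAC subrr add0r.
split.
- apply: ccontinuousD; first exact: (spectrum_shift_ccontinuous x_temp X_fourier).
  apply: ccontinuousM; first exact: (spectrum_shift_ccontinuous x_temp X_fourier).
  by apply: ccontinuousM; [exact: ccontinuous_cst|exact: ccontinuous_id].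
- have [B HB] := spectrum_shift_cs x_band qt; have [C HC] := spectrum_shift_cs x_band pt.
  exists (Num.max B C) => t; rewrite gt_max => /andP[/HB -> /HC ->].
  by rewrite mul0r addr0.
- apply: point_lipschitzD; first exact: gl.
  (* In the product of G_phi with v, G_phi is the bounded factor, being an oscillatory integral of
     an integrable function. *)
  have [i1 i2] := wsignal_integrable x_temp pt.
  have [M HM] := osc_bound (2 * pi) i1.
  apply: (@point_lipschitzM _ _ _ M); last exact: point_lipschitz_linear.
    by move=> t; rewrite (spectrum_shiftE X_fourier).
  exact: gl.
Qed.

Lemma fourier_linearized_spectrum phi s t : test_function phi ->
  fourier_fun (fun v => X (fun u => (1 - (2 * pi * u * s) *i) * phi (u + v))) t =
  wsignal x phi t - s%:C * fourier_fun (deriv_shift phi) t.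
Proof.
move=> pt.
have [dc ds dl] := deriv_shift_regular pt.
have -> : (fun v => X (fun u => (1 - (2 * pi * u * s) *i) * phi (u + v))) =
    (fun v => spectrum_shift X phi v + (- s)%:C * deriv_shift phi v).
  apply/funext => v; rewrite /spectrum_shift /deriv_shift.
  have st := test_function_shift v pt.
  have dt := test_functionM csmooth_linear_i st.
  rewrite -(spectrumZ x_temp X_fourier _ dt).
  rewrite -(spectrumD x_temp X_fourier st (test_functionZ _ dt)).
  congr X; apply/funext => u; rewrite mulrA -{2}[phi _]mul1r -mulrDl; congr (_ * _).
  by apply: ceqP; rewrite !(cReD, cImD) !(cReN, cImN) /=; ring.
have di := cs_cintegrable dc ds.
have Gi : cintegrable (spectrum_shift X phi).
  apply: cs_cintegrable; first exact: (spectrum_shift_ccontinuous x_temp X_fourier).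
  exact: (spectrum_shift_cs x_band).
rewrite fourierD//; last exact: cintegrable_onZ.
rewrite fourierZ// (fourier_spectrum_shift x_cont x_temp X_fourier x_band)//.
by rewrite -mulNr; congr (_ + _ * _); apply: ceqP => /=; rewrite ?oppr0.
Qed.

(** The offset tau of the sampling instants is a modulation of Psi in frequency, so the centred
    summation formula applies to the modulated function. *)
Lemma deriv_shift_poisson phi p tau : test_function phi -> 0 < p ->
  exists S : R[i],
  csumsZ (fun j => expj (- (2 * pi * (j%:~R * p) * tau)) * deriv_shift phi (j%:~R * p)) S /\
  csumsZ (fun k => fourier_fun (deriv_shift phi) (k%:~R / p + tau)) (p%:C * S).
Proof.
move=> pt p0; have [dc ds dl] := deriv_shift_regular pt.
pose Psi v := expj (- (2 * pi * v * tau)) * deriv_shift phi v.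
have ec : ccontinuous (fun v : R => expj (- (2 * pi * v * tau))).
  by rewrite expj_lin; exact: ccontinuous_expj_scale.
have Pc : ccontinuous Psi by exact: ccontinuousM.
have Pl : point_lipschitz Psi.
  apply: (@point_lipschitzM _ _ _ 2) => //; first by move=> t; exact: cabs_expj.
  by rewrite expj_lin; exact: point_lipschitz_expj.
have [S [h1 h2]] := poisson_summation p0 Pc (cs_mulr _ ds) Pl.
exists S; split => //; move: h2; congr csumsZ.
by apply/funext => k; rewrite (fourier_modulate (deriv_shift phi) tau).
Qed.

End interleaved_spectrum.

Section ndft.
Variables (R : realType) (N : nat).
Hypothesis N0 : (0 < N)%N.

(** As n is an integer, reducing k modulo N changes the phase by a multiple of 2 pi. *)
Lemma expj_ndft (n : nat) (k : int) :
  expj (- (2 * pi * (absz (k %% N%:Z)%Z)%:R * n%:R / N%:R)) =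
  expj (- (2 * pi * k%:~R * n%:R / N%:R)) :> R[i].
Proof.
have NR : N%:R != 0 :> R by rewrite pnatr_eq0 -lt0n.
pose q := (k %/ N%:Z)%Z.
have kE : k%:~R = q%:~R * N%:R + (absz (k %% N%:Z)%Z)%:R :> R.
  rewrite {1}(divz_eq k N%:Z) rmorphD rmorphM /= -!pmulrn; congr (_ + _).
  by rewrite -{1}[(k %% N%:Z)%Z]gez0_abs ?modz_ge0 ?eqz_nat -?lt0n.
rewrite kE; set r := (absz _)%:R.
have -> : - (2 * pi * (q%:~R * N%:R + r) * n%:R / N%:R) =
   - (2 * pi * r * n%:R / N%:R) + 2 * pi * (- (q * n%:Z))%:~R.
  rewrite mulrNz rmorphM /= -pmulrn; move: (pi : R) => w; field.
  exact: NR.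
by rewrite expjD expj_int mulr1.
Qed.
End ndft.

Theorem mainTheorem3 (R : realType) (N : nat) (fs fmax : R)
    (x : R -> R[i]) (X : distr R) (s : 'I_N -> R)
    (hN : (1 <= N)%N) (hfs : 0 < fs) (hfmax : 0 < fmax)
    (x_cont : ccontinuous x) (x_temp : tempered_fun x)
    (X_fourier : X =d fourier (distr_of_fun x))
    (x_band : band_limited fmax X) :
  skew_approx fs X s (Y_skew fs x s)
    (Y_ideal fs x -
     fs%:C *: distr_conv
                (distr_mul (fun f : R => (2 * pi * f)*i) X)
                (ndft_comb fs (fun n => (s n)%:C))).
Proof.
have NR : N%:R != 0 :> R by rewrite pnatr_eq0 -lt0n.
have fs0 : fs != 0 by rewrite gt_eqF.
split=> phi pt.
  (* First half: the two series agree term by term, so no convergence is at stake. *)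
  rewrite /Y_skew /fourier /interleaved_spectrum !fct_sumE; apply: eq_bigr => n _.
  congr csumZ; apply/funext => k; rewrite /delta.
  by rewrite (fourier_skewed_spectrum x_cont x_temp X_fourier x_band _ _ pt).
have p0 : 0 < fs / N%:R by rewrite divr_gt0// ltr0n.
pose Psi := deriv_shift X phi.
have [C HC] := wsignal_decay x_cont x_temp X_fourier x_band pt.
have dfs : 0 < fs^-1 by rewrite invr_gt0.
(* The ideal samples at k / fs split by residue modulo N: l n sums those at (k N + n) / fs, the
   instants of the n-th sub-ADC. *)
have [l [hl1 hl2]] := csumsZ_regroup (a := fun k : int => wsignal x phi (k%:~R * fs^-1))
  hN dfs (fun k => HC (k%:~R * fs^-1)).
have HS (n : 'I_N) := deriv_shift_poisson x_temp X_fourier x_band (n%:R / fs) pt p0.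
(* S n is the phase-weighted sum of Psi over the multiples of fs / N, selected for each n by
   choice. *)
pose S (n : 'I_N) := projT1 (cid (HS n)).
have S1 (n : 'I_N) : csumsZ (fun j : int => expj (- (2 * pi * (j%:~R * (fs / N%:R)) * (n%:R / fs))) *
    Psi (j%:~R * (fs / N%:R))) (S n) by exact: (projT2 (cid (HS n))).1.
have S2 (n : 'I_N) : csumsZ (fun k : int => fourier_fun Psi (k%:~R / (fs / N%:R) + n%:R / fs))
    ((fs / N%:R)%:C * S n) by exact: (projT2 (cid (HS n))).2.
have L : interleaved_spectrum fs
    (fun n => distr_mul (fun f => 1 - (2 * pi * f * s n)*i) X) phi =
  \sum_(n < N) (l n + (- (s n)%:C) * ((fs / N%:R)%:C * S n)).
  rewrite /interleaved_spectrum fct_sumE; apply: eq_bigr => n _.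
  apply: csumsZ_csumZ; rewrite /delta.
  have := csumsZD (hl1 n) (csumsZZ (- (s n)%:C) (S2 n)).
  congr csumsZ; apply/funext => k.
  transitivity (fourier_fun (fun v => X (fun u => (1 - (2 * pi * u * s n) *i) * phi (u + v)))
    (k%:~R * (N%:R / fs) + n%:R / fs)); last by [].
  rewrite (fourier_linearized_spectrum x_cont x_temp X_fourier x_band _ _ pt).
  have -> : k%:~R * (N%:R / fs) + n%:R / fs = (k * N%:Z + n%:Z)%:~R * fs^-1.
    by rewrite rmorphD rmorphM /= -!pmulrn mulrDl mulrA.
  have -> : k%:~R / (fs / N%:R) + n%:R / fs = (k * N%:Z + n%:Z)%:~R * fs^-1.
    by rewrite rmorphD rmorphM /= -!pmulrn; field; rewrite NR fs0.
  by rewrite mulNr.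
have Y1 : Y_ideal fs x phi = \sum_(n < N) l n.
  apply: csumsZ_csumZ; move: hl2; congr csumsZ.
  by apply/funext => k; rewrite /delta addr0.
have NC : N%:R^-1 = (N%:R^-1)%:C :> R[i].
  by rewrite -(rmorph_nat (real_complex R)) -fmorphV.
have Y2 : distr_conv (distr_mul (fun f : R => (2 * pi * f)*i) X)
    (ndft_comb fs (fun n => (s n)%:C)) phi =
   \sum_(n < N) ((N%:R^-1)%:C * (s n)%:C * S n).
  apply: csumsZ_csumZ.
  (* The finite sum over n passes inside the series over k, where the weights s_n / N and the phases
     of S n assemble the coefficient of the normalized DFT. *)
  have := csumsZ_sum (fun n => csumsZZ ((N%:R^-1)%:C * (s n)%:C) (S1 n)).
  congr csumsZ; apply/funext => k.
  transitivity (ndft (fun n => (s n)%:C) (absz (k %% N%:Z)%Z) * Psi (k%:~R * (fs / N%:R)));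
    last by [].
  rewrite /ndft NC mulr_sumr mulr_suml; apply: eq_bigr => n _.
  rewrite expj_ndft//.
  have -> : 2 * pi * (k%:~R * (fs / N%:R)) * (n%:R / fs) = 2 * pi * k%:~R * n%:R / N%:R.
    by move: (pi : R) => w; field; rewrite NR fs0.
  by ring.
rewrite L; transitivity (Y_ideal fs x phi - fs%:C * distr_conv (distr_mul (fun f : R => (2 * pi * f)*i) X)
    (ndft_comb fs (fun n => (s n)%:C)) phi); last by [].
(* What remains is fs / N, the Poisson factor, against fs times the 1 / N of the normalized DFT. *)
rewrite Y1 Y2 big_split /=; congr (_ + _).
rewrite mulr_sumr -sumrN; apply: eq_bigr => n _.
rewrite real_complexM mulNr; congr (- _); ring.
Qed.
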